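(* Let $\Bbbk$ be a field, $s$ a natural number, $G$ a finite abelian group, and $\chi$ an alternating bicharacter on $G$ with values in $\Bbbk^*$. If $\mathbf{x}$ ranges over all finite sets of indeterminates, $\Bbbk_{\mathfrak q}[\mathbf{x}]$ ranges among all skew polynomial rings with group of colors $G$ and bicharacter $\chi$, and $I$ ranges over all ideals in $\Bbbk_{\mathfrak q}[\mathbf{x}]$ generated by $s$ monomials of degree at least $2$, then there are only finitely many possibilities for the power series $$\frac{\mathrm{P}^{\Bbbk_{\mathfrak q}[\mathbf{x}]/I}_{\Bbbk}(t)}{(1+t)^{|\mathbf{x}|}}.$$
   Context: Skew polynomial ring: $\mathbf x=\{x_1,\ldots,x_n\}$, $|\mathbf x|=n$, $\mathfrak q=(q_{i,j})$ is an $n\times n$ matrix with entries in $\Bbbk^*$, $q_{i,i}=1$, $q_{i,j}=q_{j,i}^{-1}$. $R=\Bbbk_{\mathfrak q}[\mathbf x]$ is the Ore extension with $\Bbbk$ central and $x_ix_j=q_{i,j}x_jx_i$. Monomials are $\mathbf{x}^{\mathbf a}=x_1^{a_1}\cdots x_n^{a_n}$, $\mathbf a\in\mathbb{N}^n$; ''degree at least 2'' means $a_1+\dots+a_n\ge2$. Let $\sigma_i$ be the automorphism of $R$ over $\Bbbk$ with $\sigma_i(x_j)=q_{i,j}x_j$; the group of colors of $R$ is the abelian group $\langle\sigma_1,\ldots,\sigma_n\rangle$, and its bicharacter is the alternating bicharacter (multiplicative in each variable, $1$ on the diagonal) with $(\sigma_i,\sigma_j)\mapsto q_{i,j}$. ''$R$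 has group of colors $G$ and bicharacter $\chi$'' means that the group of colors of $R$ is identified with $G$ by a group isomorphism carrying its bicharacter to $\chi$. Poincaré series: for $S=\Bbbk_{\mathfrak q}[\mathbf x]/I$ with $I$ a monomial ideal and $M$ a finitely generated graded right $S$-module, $\beta^S_i(M)$ is the rank of the free module in degree $i$ of the minimal graded free $S$-resolution of $M$, and $\mathrm{P}^S_M(t)=\sum_{i\ge0}\beta_i^S(M)t^i$. Here $\Bbbk=S/(x_1,\ldots,x_n)$. *)

(* Defs.v *)
From HB Require Import structures.
From mathcomp Require Import all_boot all_order all_fingroup all_algebra.
From mathcomp Require Import finmap.
From mathcomp Require Import monalg.
From mathcomp Require Import mpoly.
From mathcomp.classical Require boolp.

Set Implicit Arguments.
Unset Strict Implicit.
Unset Printing Implicit Defensive.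

Import GRing.Theory.
Local Open Scope fset_scope.
Local Open Scope ring_scope.

(** * Skew polynomial rings

    The k-module of [skpoly q] is free on the commutative monomials
    [m : 'X_{1..n}], where [m] stands for the ordered monomial
    x_0 ^ m_0 * ... * x_(n-1) ^ m_(n-1)  (see [skmonE]).  Moving the variables of
    [m2] to the left across the variables of [m1] of larger index, with
    x_i x_j = q_ij x_j x_i, gives the factor [sktwist q m1 m2] in
    x^m1 * x^m2 = sktwist q m1 m2 *: x^(m1 + m2).                              *)

Definition is_skew_mx (k : fieldType) (n : nat) (q : 'M[k]_n) : Prop :=
  [/\ forall i j, q i j != 0, forall i, q i i = 1
    & forall i j, q i j = (q j i)^-1].

Definition skpoly (k : fieldType) (n : nat) (q : 'M[k]_n) : Type :=
  {malg k['X_{1..n}]}.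

(* The operations are those of [{malg k['X_{1..n}]}]; they are locked because
   unfolding them in failing conversion tests is prohibitively expensive. *)
HB.lock Definition sk0 (k : fieldType) (n : nat) (q : 'M[k]_n) : skpoly q :=
  0 : {malg k['X_{1..n}]}.

HB.lock Definition skopp (k : fieldType) (n : nat) (q : 'M[k]_n)
  (f : skpoly q) : skpoly q := - (f : {malg k['X_{1..n}]}).

HB.lock Definition skadd (k : fieldType) (n : nat) (q : 'M[k]_n)
  (f g : skpoly q) : skpoly q := (f : {malg k['X_{1..n}]}) + g.

HB.lock Definition skscale (k : fieldType) (n : nat) (q : 'M[k]_n)
  (c : k) (f : skpoly q) : skpoly q := c *: (f : {malg k['X_{1..n}]}).

HB.lock Definition skterm (k : fieldType) (n : nat) (q : 'M[k]_n)
  (c : k) (m : 'X_{1..n}) : skpoly q := monalg.mkmalgU m c.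

HB.lock Definition skcoef (k : fieldType) (n : nat) (q : 'M[k]_n)
  (m : 'X_{1..n}) (f : skpoly q) : k := monalg.mcoeff m f.

HB.lock Definition sksupp (k : fieldType) (n : nat) (q : 'M[k]_n)
  (f : skpoly q) : {fset 'X_{1..n}} := monalg.msupp f.

Section SkewModule.
Variables (k : fieldType) (n : nat) (q : 'M[k]_n).

HB.instance Definition _ := Choice.on (skpoly q).

Fact skaddA : associative (@skadd k n q).
Proof. by rewrite skadd.unlock => f g h; exact: addrA. Qed.

Fact skaddC : commutative (@skadd k n q).
Proof. by rewrite skadd.unlock => f g; exact: addrC. Qed.

Fact skadd0f : left_id (sk0 q) (@skadd k n q).
Proof. by rewrite skadd.unlock sk0.unlock => f; exact: add0r. Qed.

Fact skaddNf : left_inverse (sk0 q) (@skopp k n q) (@skadd k n q).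
Proof. by rewrite skadd.unlock sk0.unlock skopp.unlock => f; exact: addNr. Qed.

HB.instance Definition _ := GRing.isZmodule.Build (skpoly q)
  skaddA skaddC skadd0f skaddNf.

Fact skscaleA (c d : k) (f : skpoly q) :
  skscale c (skscale d f) = skscale (c * d) f.
Proof.
by rewrite skscale.unlock; exact: (scalerA c d (f : {malg k['X_{1..n}]})).
Qed.

Fact skscale1f : left_id 1 (@skscale k n q).
Proof. by rewrite skscale.unlock => f; exact: (@scale1r k {malg k['X_{1..n}]}). Qed.

Fact skscaleDr : right_distributive (@skscale k n q) +%R.
Proof.
move=> c f g; rewrite -[f + g]/(skadd f g).
rewrite -[RHS]/(skadd (skscale c f) (skscale c g)).
rewrite skscale.unlock skadd.unlock.
exact: (scalerDr c (f : {malg k['X_{1..n}]})).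
Qed.

Fact skscaleDl (f : skpoly q) : {morph (@skscale k n q)^~ f : c d / c + d}.
Proof.
move=> c d; rewrite -[RHS]/(skadd (skscale c f) (skscale d f)).
rewrite skscale.unlock skadd.unlock.
exact: (scalerDl (f : {malg k['X_{1..n}]})).
Qed.

HB.instance Definition _ := GRing.Zmodule_isLmodule.Build k (skpoly q)
  skscaleA skscale1f skscaleDr skscaleDl.

Lemma skcoefZ c m (f : skpoly q) : skcoef m (c *: f) = c * skcoef m f.
Proof.
rewrite -[c *: f]/(skscale c f) skcoef.unlock skscale.unlock.
exact: (monalg.mcoeffZ c (f : {malg k['X_{1..n}]}) m).
Qed.

Lemma skcoefU c m m' : skcoef m' (skterm q c m) = c *+ (m == m').
Proof. by rewrite skcoef.unlock skterm.unlock; exact: monalg.mcoeffU. Qed.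

Lemma skpolyP (f g : skpoly q) : (forall m, skcoef m f = skcoef m g) -> f = g.
Proof. by rewrite skcoef.unlock => /monalg.malgP. Qed.

Lemma skcoefD m (f g : skpoly q) : skcoef m (f + g) = skcoef m f + skcoef m g.
Proof.
rewrite -[f + g]/(skadd f g) skcoef.unlock skadd.unlock.
exact: (monalg.mcoeffD m (f : {malg k['X_{1..n}]})).
Qed.

Lemma skcoef0 m : skcoef m (0 : skpoly q) = 0.
Proof.
by rewrite -[0 : skpoly q]/(sk0 q) skcoef.unlock sk0.unlock; exact: monalg.mcoeff0.
Qed.

Lemma sksuppE m (f : skpoly q) : (m \in sksupp f) = (skcoef m f != 0).
Proof. by rewrite skcoef.unlock sksupp.unlock monalg.mcoeff_neq0. Qed.

End SkewModule.

Definition sktwist (k : fieldType) (n : nat) (q : 'M[k]_n) (m1 m2 : 'X_{1..n}) : k :=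
  \prod_(i < n) \prod_(j < n | (j < i)%N) q i j ^+ (m1 i * m2 j).

HB.lock Definition skmul (k : fieldType) (n : nat) (q : 'M[k]_n)
    (f g : skpoly q) : skpoly q :=
  \sum_(m1 <- sksupp f) \sum_(m2 <- sksupp g)
    skterm q (skcoef m1 f * skcoef m2 g * sktwist q m1 m2) (m1 + m2)%MM.

(* The diagonal map x_i |-> u_i x_i. *)
HB.lock Definition sktorus (k : fieldType) (n : nat) (q : 'M[k]_n)
    (u : 'I_n -> k) (f : skpoly q) : skpoly q :=
  monalg.mkmalg
    [fsfun m in sksupp f => skcoef m f * \prod_(i < n) u i ^+ m i].

Section SkewPolynomials.
Variables (k : fieldType) (n : nat) (q : 'M[k]_n).
Implicit Types (m : 'X_{1..n}) (c : k) (f g h : skpoly q).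

Lemma sktwistDl m1 m2 m3 :
  sktwist q (m1 + m2)%MM m3 = sktwist q m1 m3 * sktwist q m2 m3.
Proof.
rewrite /sktwist -big_split; apply: eq_bigr => i _ /=.
rewrite -big_split; apply: eq_bigr => j _ /=.
by rewrite mnmDE mulnDl exprD.
Qed.

Lemma sktwistDr m1 m2 m3 :
  sktwist q m1 (m2 + m3)%MM = sktwist q m1 m2 * sktwist q m1 m3.
Proof.
rewrite /sktwist -big_split; apply: eq_bigr => i _ /=.
rewrite -big_split; apply: eq_bigr => j _ /=.
by rewrite mnmDE mulnDr exprD.
Qed.

Lemma sktwist0m m : sktwist q 0%MM m = 1.
Proof.
by apply: big1 => i _; apply: big1 => j _; rewrite mnm0E mul0n expr0.
Qed.

Lemma sktwistm0 m : sktwist q m 0%MM = 1.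
Proof.
by apply: big1 => i _; apply: big1 => j _; rewrite mnm0E muln0 expr0.
Qed.

Definition skone : skpoly q := skterm q 1 0%MM.

Lemma skterm0 m : skterm q 0 m = 0.
Proof. by apply: skpolyP => m'; rewrite skcoefU skcoef0 mul0rn. Qed.

Lemma sktermD c1 c2 m : skterm q (c1 + c2) m = skterm q c1 m + skterm q c2 m.
Proof. by apply: skpolyP => m'; rewrite skcoefD !skcoefU mulrnDl. Qed.

Lemma sktermZ c1 c2 m : c1 *: skterm q c2 m = skterm q (c1 * c2) m.
Proof. by apply: skpolyP => m'; rewrite skcoefZ !skcoefU mulrnAr. Qed.

Lemma skcoef_sum (I : Type) (r : seq I) (F : I -> skpoly q) m :
  skcoef m (\sum_(i <- r) F i) = \sum_(i <- r) skcoef m (F i).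
Proof.
by elim: r => [|i r IH]; rewrite ?big_nil ?skcoef0 // !big_cons skcoefD IH.
Qed.

Lemma sksuppPn m f : m \notin sksupp f -> skcoef m f = 0.
Proof. by rewrite sksuppE negbK => /eqP. Qed.

Lemma skE f : f = \sum_(m <- sksupp f) skterm q (skcoef m f) m.
Proof.
apply: skpolyP => m; rewrite skcoef_sum.
under eq_bigr do rewrite skcoefU.
have [mf|/[dup] mf /sksuppPn ->] := boolP (m \in sksupp f).
  rewrite (big_fsetD1 m) //= eqxx big1_fset ?addr0 // => m' /fsetD1P[ne _] _.
  by rewrite (negPf ne).
rewrite big1_fset // => m' m'f _; case: eqP mf => [<-|//].
by rewrite m'f.
Qed.

Lemma sksuppD f g : sksupp (f + g) `<=` sksupp f `|` sksupp g.
Proof.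
apply/fsubsetP => m; rewrite in_fsetU !sksuppE skcoefD -negb_and.
by apply: contraNN => /andP[/eqP-> /eqP->]; rewrite addr0.
Qed.

Lemma sksupp0 : sksupp (0 : skpoly q) = fset0.
Proof. by apply/fsetP => m; rewrite sksuppE skcoef0 eqxx in_fset0. Qed.

Lemma sksuppU c m : sksupp (skterm q c m) `<=` [fset m].
Proof.
apply/fsubsetP => m'; rewrite in_fset1 sksuppE skcoefU [m == m']eq_sym.
by case: (m' == m) => //; rewrite mulr0n eqxx.
Qed.

Lemma skmulw (d1 d2 : {fset 'X_{1..n}}) f g :
  sksupp f `<=` d1 -> sksupp g `<=` d2 ->
  skmul f g = \sum_(m1 <- d1) \sum_(m2 <- d2)
    skterm q (skcoef m1 f * skcoef m2 g * sktwist q m1 m2) (m1 + m2)%MM.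
Proof.
move=> le_d1 le_d2; rewrite skmul.unlock (big_fset_incl _ le_d1) /=.
  apply/eq_bigr=> m1 _; apply/big_fset_incl => // m _ /sksuppPn ->.
  by rewrite mulr0 mul0r skterm0.
move=> m _ /sksuppPn e.
by rewrite big1 // => m' _; rewrite e !mul0r skterm0.
Qed.

Lemma skmulUU c1 c2 m1 m2 :
  skmul (skterm q c1 m1) (skterm q c2 m2)
  = skterm q (c1 * c2 * sktwist q m1 m2) (m1 + m2)%MM.
Proof.
by rewrite (skmulw (sksuppU _ _) (sksuppU _ _)) !big_seq_fset1 !skcoefU !eqxx.
Qed.

Lemma skmulDl : left_distributive (@skmul k n q) +%R.
Proof.
move=> f1 f2 g.
rewrite [in RHS](skmulw (fsubsetUl (sksupp f1) (sksupp f2)) (fsubset_refl _)).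
rewrite [in RHS](skmulw (fsubsetUr (sksupp f1) (sksupp f2)) (fsubset_refl _)).
rewrite (skmulw (sksuppD _ _) (fsubset_refl _)).
rewrite -big_split /=; apply/eq_bigr=> m1 _.
rewrite -big_split /=; apply/eq_bigr=> m2 _.
by rewrite skcoefD !mulrDl sktermD.
Qed.

Lemma skmulDr : right_distributive (@skmul k n q) +%R.
Proof.
move=> f g1 g2.
rewrite [in RHS](skmulw (fsubset_refl _) (fsubsetUl (sksupp g1) (sksupp g2))).
rewrite [in RHS](skmulw (fsubset_refl _) (fsubsetUr (sksupp g1) (sksupp g2))).
rewrite (skmulw (fsubset_refl _) (sksuppD _ _)).
rewrite -big_split /=; apply/eq_bigr=> m1 _.
rewrite -big_split /=; apply/eq_bigr=> m2 _.
by rewrite skcoefD mulrDr !mulrDl sktermD.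
Qed.

Lemma skmul0r : left_zero 0 (@skmul k n q).
Proof. by move=> f; rewrite skmul.unlock sksupp0 big_seq_fset0. Qed.

Lemma skmulr0 : right_zero 0 (@skmul k n q).
Proof.
move=> f; rewrite skmul.unlock big1 // => m _.
by rewrite sksupp0 big_seq_fset0.
Qed.

Lemma skmul_suml (I : Type) (r : seq I) (F : I -> skpoly q) g :
  skmul (\sum_(i <- r) F i) g = \sum_(i <- r) skmul (F i) g.
Proof.
by elim: r => [|i r IH]; rewrite ?big_nil ?skmul0r // !big_cons skmulDl IH.
Qed.

Lemma skmul_sumr (I : Type) (r : seq I) (F : I -> skpoly q) g :
  skmul g (\sum_(i <- r) F i) = \sum_(i <- r) skmul g (F i).
Proof.
by elim: r => [|i r IH]; rewrite ?big_nil ?skmulr0 // !big_cons skmulDr IH.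
Qed.

Lemma skmulA : associative (@skmul k n q).
Proof.
move=> f g h; rewrite (skE f) [in RHS]skmul_suml [in RHS]skmul_suml skmul_suml.
apply: eq_bigr => m1 _; rewrite (skE g) skmul_suml !skmul_sumr skmul_suml.
apply: eq_bigr => m2 _; rewrite (skE h) !skmul_sumr.
apply: eq_bigr => m3 _; rewrite !skmulUU addmA sktwistDl sktwistDr.
congr skterm.
rewrite -!mulrA; congr (_ * _); congr (_ * _).
by rewrite [RHS]mulrCA; congr (_ * _); rewrite mulrC mulrA.
Qed.

Lemma skmul1r : left_id skone (@skmul k n q).
Proof.
move=> f; rewrite {1}(skE f) skmul_sumr [RHS]skE; apply: eq_bigr => m _.
by rewrite skmulUU add0m sktwist0m mul1r mulr1.
Qed.

Lemma skmulr1 : right_id skone (@skmul k n q).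
Proof.
move=> f; rewrite {1}(skE f) skmul_suml [RHS]skE; apply: eq_bigr => m _.
by rewrite skmulUU addm0 sktwistm0 !mulr1.
Qed.

Lemma skone_neq0 : skone != 0.
Proof.
apply/eqP => /(congr1 (skcoef 0%MM)) /eqP.
by rewrite skcoefU skcoef0 eqxx oner_eq0.
Qed.

HB.instance Definition _ := GRing.Zmodule_isNzRing.Build (skpoly q)
  skmulA skmul1r skmulr1 skmulDl skmulDr skone_neq0.

Lemma skscaleAl c (f g : skpoly q) : c *: (f * g) = (c *: f) * g.
Proof.
have E (h : skpoly q) : c *: h = skmul (skterm q c 0%MM) h.
  rewrite {1 2}(skE h) skmul_sumr scaler_sumr; apply: eq_bigr => m _.
  by rewrite skmulUU sktermZ add0m sktwist0m mulr1.
by rewrite !E; exact: skmulA.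
Qed.

HB.instance Definition _ :=
  GRing.Lmodule_isLalgebra.Build k (skpoly q) skscaleAl.

Lemma skscaleAr c (f g : skpoly q) : c *: (f * g) = f * (c *: g).
Proof.
have E (h : skpoly q) : c *: h = skmul h (skterm q c 0%MM).
  rewrite {1 2}(skE h) skmul_suml scaler_sumr; apply: eq_bigr => m _.
  by rewrite skmulUU sktermZ addm0 sktwistm0 mulr1 mulrC.
by rewrite !E; apply: esym; exact: skmulA.
Qed.

HB.instance Definition _ :=
  GRing.Lalgebra_isAlgebra.Build k (skpoly q) skscaleAr.

Definition skX (i : 'I_n) : skpoly q := skterm q 1 U_(i)%MM.

Definition skmon m : skpoly q := \prod_(i < n) skX i ^+ m i.

Lemma sktermM c1 c2 m1 m2 :
  skterm q c1 m1 * skterm q c2 m2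
  = skterm q (c1 * c2 * sktwist q m1 m2) (m1 + m2)%MM.
Proof. exact: skmulUU. Qed.

Lemma sktwistU (i j : 'I_n) :
  sktwist q U_(i)%MM U_(j)%MM = if (j < i)%N then q i j else 1.
Proof.
rewrite /sktwist (bigD1 i) //= [X in _ * X]big1 ?mulr1.
  case: ifP => ji.
    rewrite (bigD1 j) //= big1 ?mulr1.
      by rewrite !mnm1E !eqxx expr1.
    by move=> l /andP[_ /negPf lj]; rewrite !mnm1E [j == l]eq_sym lj muln0.
  rewrite big1 // => l li; rewrite !mnm1E; case: (eqVneq j l) => [e|].
    by move: ji; rewrite e li.
  by rewrite muln0.
move=> l /negPf li; rewrite big1 // => l' _.
by rewrite mnm1E [i == l]eq_sym li mul0n.
Qed.

Lemma skX_comm : is_skew_mx q ->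
  forall i j, skX i * skX j = q i j *: (skX j * skX i).
Proof.
move=> [q0 q1 qV] i j; rewrite !sktermM sktermZ !sktwistU addmC !mul1r.
congr skterm; case: (ltngtP i j) => [ij|ij|/val_inj->].
- by rewrite [q j i]qV mulfV.
- by rewrite mulr1.
- by rewrite q1 mulr1.
Qed.

Lemma skXX (i : 'I_n) d : skX i ^+ d = skterm q 1 (U_(i) *+ d)%MM.
Proof.
elim: d => [|d IH]; first by rewrite expr0 mulm0n.
rewrite exprS IH sktermM mulmS !mul1r; congr skterm.
apply: big1 => a _; apply: big1 => b ba.
rewrite mulmnE !mnm1E; case: (eqVneq i a) => [ia|]; last by rewrite mul0n.
by rewrite ia; case: eqVneq ba => [->|]; rewrite ?ltnn // !mul0n muln0.
Qed.

Lemma skmonE m : skmon m = skterm q 1 m.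
Proof.
pose trunc (d : nat) := [multinom if (i < d)%N then m i else 0%N | i < n].
suff H d : (d <= n)%N ->
    \prod_(i < n | (i < d)%N) skX i ^+ m i = skterm q 1 (trunc d).
  have := H n (leqnn n).
  rewrite /skmon (eq_bigl xpredT) => [->|i]; last by rewrite ltn_ord.
  by congr skterm; apply/mnmP => i; rewrite mnmE ltn_ord.
elim: d => [_|d IH dn].
  have -> : trunc 0%N = 0%MM by apply/mnmP => i; rewrite !mnmE.
  by rewrite big_pred0.
have step (F : 'I_n -> skpoly q) :
    \prod_(i < n | (i < d.+1)%N) F i
    = (\prod_(i < n | (i < d)%N) F i) * F (Ordinal dn).
  have e : n = (d.+1 + (n - d.+1))%N by rewrite subnKC.
  have gen b : (b <= n)%N -> \prod_(i < n | (i < b)%N) F i =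
      \prod_(0 <= j < b) (if insub j is Some i then F i else 1).
    move=> bn; rewrite big_mkord.
    rewrite (big_ord_widen_cond n xpredT
      (fun j => if insub j is Some i then F i else 1)) //.
    by apply: eq_bigr => i _; rewrite valK.
  rewrite !gen ?(ltnW dn) // big_nat_recr //=; congr (_ * _).
  by rewrite insubT.
rewrite step IH ?(ltnW dn) // skXX sktermM !mul1r.
have -> : sktwist q (trunc d) (U_(Ordinal dn) *+ m (Ordinal dn))%MM = 1.
  apply: big1 => a _; apply: big1 => b ba.
  rewrite mulmnE mnm1E mnmE.
  case: (eqVneq (Ordinal dn) b) => [e|]; last by rewrite mul0n muln0.
  by move: ba; rewrite -e /= ltnNge => /negPf; rewrite leq_eqVlt orbC => /norP[/negPf-> _].
congr skterm; apply/mnmP => i; rewrite mnmDE mulmnE !mnmE.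
case: (eqVneq (Ordinal dn) i) => [<-|ne] /=.
  by rewrite ltnn ltnSn mul1n.
rewrite mul0n addn0 [(i < d.+1)%N]ltnS [(i <= d)%N]leq_eqVlt.
by case: eqP => // id; case/eqP: ne; apply: val_inj.
Qed.

Lemma skcoef_torus u m f :
  skcoef m (sktorus u f) = skcoef m f * \prod_(i < n) u i ^+ m i.
Proof.
rewrite sktorus.unlock [LHS](_ : _ = if m \in sksupp f
  then skcoef m f * \prod_(i < n) u i ^+ m i else 0).
  by case: ifPn => // /sksuppPn ->; rewrite mul0r.
by rewrite {1}skcoef.unlock; exact: monalg.mcoeffE.
Qed.

Lemma sktorusU u c m :
  sktorus u (skterm q c m) = skterm q (c * \prod_(i < n) u i ^+ m i) m.
Proof.
apply: skpolyP => m'; rewrite skcoef_torus !skcoefU.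
by case: eqVneq => [->|]; rewrite ?mulr1n ?mulr0n ?mul0r.
Qed.

Lemma sktorus_linear u : linear (@sktorus k n q u).
Proof.
move=> c f g; apply: skpolyP => m.
by rewrite skcoef_torus !skcoefD !skcoefZ !skcoef_torus mulrDl mulrA.
Qed.

HB.instance Definition _ u :=
  GRing.isLinear.Build k (skpoly q) (skpoly q) *:%R (@sktorus k n q u)
    (sktorus_linear u).

Lemma sktorus_monoid u : monoid_morphism (@sktorus k n q u).
Proof.
split=> [|f g].
  rewrite -[1]/skone /skone sktorusU mul1r big1 // => i _.
  by rewrite mnmE expr0.
rewrite (skE f) (skE g) raddf_sum !mulr_suml raddf_sum; apply: eq_bigr => m1 _.
rewrite raddf_sum !mulr_sumr raddf_sum; apply: eq_bigr => m2 _.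
rewrite /= sktermM !sktorusU sktermM; congr (skterm q _ _).
rewrite [in RHS]mulrACA [LHS]mulrAC; congr (_ * _ * _).
by rewrite -big_split; apply: eq_bigr => i _; rewrite mnmDE exprD.
Qed.

HB.instance Definition _ u :=
  GRing.isMonoidMorphism.Build (skpoly q) (skpoly q) (@sktorus k n q u)
    (sktorus_monoid u).

Lemma sktorusX u i : sktorus u (skX i) = u i *: skX i.
Proof.
rewrite sktorusU sktermZ mul1r mulr1 (bigD1 i) //= mnm1E eqxx expr1.
rewrite big1 ?mulr1 // => j /negPf ji.
by rewrite mnm1E eq_sym ji expr0.
Qed.

Lemma sktorusK u : (forall i, u i != 0) ->
  cancel (@sktorus k n q u) (@sktorus k n q (fun i => (u i)^-1)).
Proof.
move=> u0 f; apply: skpolyP => m; rewrite !skcoef_torus -mulrA -big_split /=.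
by rewrite big1 ?mulr1 // => i _; rewrite exprVn mulfV // expf_neq0.
Qed.

Definition sksigma (i : 'I_n) : skpoly q -> skpoly q := sktorus (q i).

(** The group of colors: the group of bijections of [skpoly q] generated by the
    automorphisms [sksigma i].                                               *)
Inductive skcolor : (skpoly q -> skpoly q) -> Prop :=
| skcolor_id : skcolor idfun
| skcolor_sigma i : skcolor (sksigma i)
| skcolor_comp u v : skcolor u -> skcolor v -> skcolor (u \o v)
| skcolor_inv u v : skcolor u -> cancel u v -> cancel v u -> skcolor v.

(** Homogeneous elements for the standard grading (every variable has degree 1);
    the degree is an integer so that shifts need no side condition.            *)
Definition skhomog (e : int) (f : skpoly q) : Prop :=
  forall m, m \in sksupp f -> (mdeg m)%:Z = e.

End SkewPolynomials.

Arguments sksigma {k n} q i f.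

Definition is_alt_bicharacter (k : fieldType) (gT : finGroupType)
    (G : {group gT}) (chi : gT -> gT -> k) : Prop :=
  [/\ {in G &, forall g h, chi g h != 0},
      {in G & &, forall g1 g2 h, chi (g1 * g2)%g h = chi g1 h * chi g2 h},
      {in G & &, forall g h1 h2, chi g (h1 * h2)%g = chi g h1 * chi g h2}
    & {in G, forall g, chi g g = 1}].

(** [phi] is a group isomorphism from [G] onto the group of colors; since [chi] is
    bimultiplicative on [G], it corresponds under [phi] to the bicharacter of
    [skpoly q] as soon as it takes the value q_ij at (sigma_i, sigma_j).      *)
Definition has_colors (k : fieldType) (gT : finGroupType) (G : {group gT})
    (chi : gT -> gT -> k) (n : nat) (q : 'M[k]_n) : Prop :=
  exists phi : gT -> skpoly q -> skpoly q,
    [/\ {in G &, forall g h, phi (g * h)%g = phi g \o phi h},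
        {in G &, injective phi},
        forall f, skcolor f <-> exists2 g, g \in G & phi g = f
      & forall i j, {in G &, forall g h, phi g = sksigma q i ->
          phi h = sksigma q j -> chi g h = q i j}].

Section IdealQuotient.
Variables (A : pzRingType) (X : A -> Prop).

Definition ideal_gen : {pred A} := fun r =>
  boolp.asbool (exists2 l : seq (A * A * A),
    (forall t, t \in l -> X t.1.2) & r = \sum_(t <- l) t.1.1 * t.1.2 * t.2).

Lemma ideal_genP r : reflect
  (exists2 l : seq (A * A * A),
    (forall t, t \in l -> X t.1.2) & r = \sum_(t <- l) t.1.1 * t.1.2 * t.2)
  (r \in ideal_gen).
Proof. exact: boolp.asboolP. Qed.

Lemma ideal_genMl a r : r \in ideal_gen -> a * r \in ideal_gen.
Proof.
case/ideal_genP => l lX ->; apply/ideal_genP.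
exists [seq (a * t.1.1, t.1.2, t.2) | t <- l].
  by move=> _ /mapP[t /lX Xt ->].
by rewrite big_map mulr_sumr; apply: eq_bigr => t _; rewrite /= !mulrA.
Qed.

Lemma ideal_genMr a r : r \in ideal_gen -> r * a \in ideal_gen.
Proof.
case/ideal_genP => l lX ->; apply/ideal_genP.
exists [seq (t.1.1, t.1.2, t.2 * a) | t <- l].
  by move=> _ /mapP[t /lX Xt ->].
by rewrite big_map mulr_suml; apply: eq_bigr => t _; rewrite /= !mulrA.
Qed.

Lemma ideal_gen_zmod_closed : zmod_closed ideal_gen.
Proof.
split=> [|r s].
  by apply/ideal_genP; exists [::] => //; rewrite big_nil.
case/ideal_genP => l lX ->; case/ideal_genP => l' lX' ->; apply/ideal_genP.
exists (l ++ [seq (- t.1.1, t.1.2, t.2) | t <- l']).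
  by move=> t; rewrite mem_cat => /orP[/lX//|/mapP[t' /lX' Xt ->]].
rewrite big_cat big_map /= -sumrN; congr (_ + _).
by apply: eq_bigr => t _; rewrite !mulNr.
Qed.

HB.instance Definition _ := GRing.isZmodClosed.Build A ideal_gen
  ideal_gen_zmod_closed.

Definition idquot : Type := Quotient.quot ideal_gen.

HB.instance Definition _ := Choice.on idquot.
HB.instance Definition _ := GRing.Zmodule.on idquot.

Definition idproj (a : A) : idquot := (\pi_(Quotient.quot ideal_gen) a)%qT.

Lemma idprojP (x : idquot) : exists a, x = idproj a.
Proof. by exists (generic_quotient.repr x); rewrite /idproj reprK. Qed.

Lemma eq_idproj a b : idproj a = idproj b <-> a - b \in ideal_gen.
Proof. by rewrite Quotient.idealrBE; split=> /eqP. Qed.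

Lemma idprojB : {morph idproj : a b / a - b}.
Proof.
move=> a b; rewrite -[RHS]/(Quotient.add (idproj a) (Quotient.opp (idproj b))).
by rewrite /idproj -Quotient.pi_opp -Quotient.pi_add.
Qed.

HB.instance Definition _ := GRing.isZmodMorphism.Build A idquot idproj idprojB.

Definition idquot_mul (x y : idquot) : idquot :=
  idproj (generic_quotient.repr x * generic_quotient.repr y).

Lemma idprojM_def a b : idproj (a * b) = idquot_mul (idproj a) (idproj b).
Proof.
have rP c : c - generic_quotient.repr (idproj c) \in ideal_gen.
  by apply/eq_idproj; rewrite /idproj reprK.
apply/eq_idproj.
set a' := generic_quotient.repr _; set b' := generic_quotient.repr _.
rewrite -(subrKA (a' * b)) -mulrBl -mulrBr.
by apply: rpredD; [apply: ideal_genMr | apply: ideal_genMl]; exact: rP.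
Qed.

Fact idquot_mulA : associative idquot_mul.
Proof.
move=> x y z; case: (idprojP x) (idprojP y) (idprojP z) => a -> [b ->] [c ->].
by rewrite -!idprojM_def mulrA.
Qed.

Fact idquot_mul1 : left_id (idproj 1) idquot_mul.
Proof. by move=> x; have [a ->] := idprojP x; rewrite -idprojM_def mul1r. Qed.

Fact idquot_mulr1 : right_id (idproj 1) idquot_mul.
Proof. by move=> x; have [a ->] := idprojP x; rewrite -idprojM_def mulr1. Qed.

Fact idquot_mulDl : left_distributive idquot_mul +%R.
Proof.
move=> x y z; case: (idprojP x) (idprojP y) (idprojP z) => a -> [b ->] [c ->].
by rewrite -raddfD -!idprojM_def -raddfD mulrDl.
Qed.

Fact idquot_mulDr : right_distributive idquot_mul +%R.
Proof.
move=> x y z; case: (idprojP x) (idprojP y) (idprojP z) => a -> [b ->] [c ->].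
by rewrite -raddfD -!idprojM_def -raddfD mulrDr.
Qed.

HB.instance Definition _ := GRing.Zmodule_isPzRing.Build idquot
  idquot_mulA idquot_mul1 idquot_mulr1 idquot_mulDl idquot_mulDr.

Fact idproj_monoid_morphism : monoid_morphism idproj.
Proof. by split=> // a b; exact: idprojM_def. Qed.

HB.instance Definition _ := GRing.isMonoidMorphism.Build A idquot idproj
  idproj_monoid_morphism.

(* A right A-module is an [lmodType A^c]: [a *: x] stands for x a. *)
Definition idquot_act (a : A^c) (x : idquot) : idquot := x * idproj a.

Fact idquot_actA a b x : idquot_act a (idquot_act b x) = idquot_act (a * b) x.
Proof. by rewrite /idquot_act -mulrA -rmorphM. Qed.

Fact idquot_act1 : left_id 1 idquot_act.
Proof. by move=> x; rewrite /idquot_act (rmorph1 idproj) mulr1. Qed.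

Fact idquot_actDr : right_distributive idquot_act +%R.
Proof. by move=> a x y; rewrite /idquot_act mulrDl. Qed.

Fact idquot_actDl x : {morph idquot_act^~ x : a b / a + b}.
Proof. by move=> a b; rewrite /idquot_act (raddfD idproj) mulrDr. Qed.

HB.instance Definition _ := GRing.Zmodule_isLmodule.Build A^c idquot
  idquot_actA idquot_act1 idquot_actDr idquot_actDl.

Definition idquot_homog (gr : int -> A -> Prop) (e : int) (x : idquot) :
    Prop :=
  exists2 a, gr e a & x = idproj a.

End IdealQuotient.

(** * Minimal graded free resolutions of right modules

    [A] is graded by [gr], with irrelevant ideal [irr], and [M] is a right
    module graded by [grM].  The right module A^b is [free_mod A b]; in the
    graded free module with generators of degrees [d j] a vector is homogeneous
    of degree e if its j-th entry is homogeneous of degree e - d_j.            *)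

Definition free_mod (A : pzRingType) (b : nat) : lmodType A^c := 'cV[A^c]_b.

Definition free_homog (A : pzRingType) (gr : int -> A -> Prop)
    (b : nat) (d : 'I_b -> int) (e : int) (v : free_mod A b) : Prop :=
  forall j, gr (e - d j) (v j 0).

Record min_graded_resolution (A : pzRingType) (gr : int -> A -> Prop)
    (irr : {pred A}) (M : lmodType A^c) (grM : int -> M -> Prop) : Type :=
  MinGradedResolution {
    res_rank : nat -> nat;
    res_deg : forall i, 'I_(res_rank i) -> int;
    res_aug : {linear free_mod A (res_rank 0) -> M};
    res_diff : forall i,
      {linear free_mod A (res_rank i.+1) -> free_mod A (res_rank i)};
    res_aug_homog : forall e v,
      free_homog gr (@res_deg 0%N) e v -> grM e (res_aug v);
    res_diff_homog : forall i e v,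
      free_homog gr (@res_deg i.+1) e v ->
      free_homog gr (@res_deg i) e (res_diff i v);
    res_aug_surj : forall x, exists v, res_aug v = x;
    res_aug_exact : forall v, res_aug v = 0 <-> exists w, res_diff 0 w = v;
    res_diff_exact : forall i v,
      res_diff i v = 0 <-> exists w, res_diff i.+1 w = v;
    res_minimal : forall i w j, res_diff i w j 0 \in irr
  }.

Section MonomialQuotient.
Variables (k : fieldType) (n : nat) (q : 'M[k]_n).
Variables (s : nat) (a : 'I_s -> 'X_{1..n}).

Definition monquot : pzRingType :=
  idquot (fun r : skpoly q => exists i, r = skmon q (a i)).

Definition monquot_homog : int -> monquot -> Prop :=
  idquot_homog (@skhomog k n q).

Definition monquot_var (x : monquot) : Prop :=
  exists i : 'I_n, x = idproj _ (skX q i).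

Definition monquot_irr : {pred monquot} := ideal_gen monquot_var.

Definition resfield : lmodType monquot^c := idquot monquot_var.

Definition resfield_homog : int -> resfield -> Prop :=
  idquot_homog monquot_homog.

Definition is_poincare_resfield (P : nat -> nat) : Prop :=
  exists F : min_graded_resolution monquot_homog monquot_irr resfield_homog,
    forall i, P i = res_rank F i.

End MonomialQuotient.

(** [f] is the power series P / (1 + t)^n, i.e. P = (1 + t)^n f. *)
Definition is_quot_1t (P : nat -> nat) (n : nat) (f : nat -> int) : Prop :=
  forall i, (P i)%:Z =
    \sum_(j < i.+1) (((1 + 'X) ^+ n : {poly int})`_j) * f (i - j)%N.

(* Main.v *)
(** Betti numbers of the residue field k are dimensions of Tor_i(k, k), and these
    change in a controlled way under reduction by a regular normal element c that
    lies in the maximal ideal J of S but not in J^2: as J / Jc is the direct sum of k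
    and of the maximal ideal of S / c, shifting dimensions gives
    P^S_k = (1 + t) P^(S/c)_k, so that P / (1 + t)^n is the same for S and S / c.

    Polarize the monomials a_1, ..., a_s and, for every subset A of the indices,
    multiply together the variables that divide exactly the a_t with t in A: the a_t
    become products of at most 2^s variables w_A, each of which is replaced by two
    factors if its degree permits, so that all degrees stay at least 2.  Giving w_A
    the color of the product mu_A of the original variables makes w_A - mu_A normal,
    and these differences form a regular sequence in the ring on the variables x and
    w modulo the monomials in the w_A; modulo them one recovers the original ring,
    and modulo the x_i a ring that depends only on which w_A occur and on their
    colors in the finite group G.  Two rings with the same such datum are compared
    through a common ring, which has both of their sets of variables and the w_A. *)
Require Import Defs.
From HB Require Import structures.
From mathcomp Require Import all_boot all_order all_fingroup all_algebra.
From mathcomp Require Import finmap monalg mpoly.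
From mathcomp.classical Require boolp.
From mathcomp Require Import zify.

Set Implicit Arguments.
Unset Strict Implicit.
Unset Printing Implicit Defensive.

Import GRing.Theory.
Local Open Scope ring_scope.

(** * Modules *)

(** Dimensions of Tor are treated as a relation, and each reduction step carries them from S / c up
    to S. This is why two rings are compared through a ring lying above both of them: the numbers of
    either one rise to the common ring, where the uniqueness of Tor dimensions equates the results.
    Seen from one of the two rings, the w_A specialize to monomials and the variables of the other
    ring to 0; both are instances of a single substitution. The obstacle is the regularity of the
    differences w_A - mu_A. It rests on a chain condition: for a fixed variable x_i, the sets A for
    which x_i divides mu_A are level sets of the exponent of x_i, hence nested. Degrees at least 2
    matter because the monomials then have no linear part, so that the coefficient of w_A is defined
    modulo them and shows that the difference is not in J^2; this is the reason for splitting w_A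
    into two factors. *)

Lemma linear_of (R : pzRingType) (U V : lmodType R) (f : U -> V) :
  linear f -> exists g : {linear U -> V}, g =1 f.
Proof.
move=> H; pose m := GRing.isLinear.Build _ _ _ _ f H.
by pose F : {linear U -> V} := HB.pack f m; exists F.
Qed.

Section Kernel.
Variables (R : pzRingType) (U V : lmodType R) (f : {linear U -> V}).

Definition lkernel : {pred U} := fun x => f x == 0.

Fact lkernel_submod_closed : submod_closed lkernel.
Proof.
split=> [|a x y]; first by rewrite unfold_in linear0.
rewrite !unfold_in => /eqP fx /eqP fy.
by rewrite linearP fx fy scaler0 addr0.
Qed.
HB.instance Definition _ :=
  GRing.isSubmodClosed.Build R U lkernel lkernel_submod_closed.

Record lkernel_type := LKernel { lkernel_val : U; _ : lkernel_val \in lkernel }.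
HB.instance Definition _ := [isSub for lkernel_val].
HB.instance Definition _ := [Choice of lkernel_type by <:].
HB.instance Definition _ := [SubChoice_isSubLmodule of lkernel_type by <:].
End Kernel.

Definition short_exact (R : pzRingType) (N L M : lmodType R)
    (u : {linear N -> L}) (v : {linear L -> M}) : Prop :=
  [/\ injective u, forall y, exists x, v x = y
    & forall x, v x = 0 <-> exists z, u z = x].

Lemma short_exact_ker (R : pzRingType) (L M : lmodType R)
  (v : {linear L -> M}) : (forall y, exists x, v x = y) ->
  exists (N : lmodType R) (u : {linear N -> L}), short_exact u v.
Proof.
move=> vS; exists (lkernel_type v), (val : {linear lkernel_type v -> L}).
split=> // [|x]; first exact: val_inj.
split=> [vx0|[z <-]]; last by apply/eqP; exact: (valP z).
by exists (Sub x (introT eqP vx0)); exact: SubK.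
Qed.

Lemma lift_mono (R : pzRingType) (X N L : lmodType R) (u : {linear N -> L})
    (h : {linear X -> L}) : injective u -> (forall x, exists z, u z = h x) ->
  exists h' : {linear X -> N}, forall x, u (h' x) = h x.
Proof.
move=> uI /boolp.choice[f fP].
have /linear_of[g gE] : linear f.
  by move=> a x y; apply: uI; rewrite linearP !fP linearP.
by exists g => x; rewrite gE.
Qed.

(** * Projective modules, and free modules on arbitrary sets *)

Definition projective (R : pzRingType) (P : lmodType R) : Prop :=
  forall (X Y : lmodType R) (g : {linear X -> Y}) (f : {linear P -> Y}),
    (forall y, exists x, g x = y) ->
    exists h : {linear P -> X}, forall p, g (h p) = f p.

Lemma projective_prod (R : pzRingType) (P Q : lmodType R) :
  projective P -> projective Q -> projective (P * Q)%type.
Proof.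
move=> pP pQ X Y g f gS.
have /linear_of[f1 f1E] : linear (fun p : P => f (p, 0)).
  move=> a x y; rewrite -linearP; congr (f _).
  by apply: injective_projections; rewrite /= ?scaler0 ?addr0.
have /linear_of[f2 f2E] : linear (fun p : Q => f (0, p)).
  move=> a x y; rewrite -linearP; congr (f _).
  by apply: injective_projections; rewrite /= ?scaler0 ?addr0.
have [h1 h1P] := pP _ _ g f1 gS; have [h2 h2P] := pQ _ _ g f2 gS.
have /linear_of[h hE] : linear (fun x : P * Q => h1 x.1 + h2 x.2).
  by move=> a x y; rewrite /= !linearP scalerDr addrACA.
exists h => -[x y]; rewrite hE linearD h1P h2P f1E f2E -linearD /=.
by congr (f _); apply: injective_projections; rewrite /= ?addr0 ?add0r.
Qed.

Lemma projective_cV (R : pzRingType) b : projective ('cV[R]_b : lmodType R).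
Proof.
move=> X Y g f gS; have [z zP] := boolp.choice gS.
have /linear_of[h hE] : linear (fun v : 'cV[R]_b =>
    \sum_i v i 0 *: z (f (delta_mx i 0))).
  move=> a x y; rewrite scaler_sumr -big_split; apply: eq_bigr => i _.
  by rewrite !mxE scalerDl scalerA.
exists h => v; rewrite hE linear_sum [in RHS](matrix_sum_delta v) linear_sum.
by apply: eq_bigr => i _; rewrite big_ord1 !linearZ /= zP.
Qed.

Lemma projective_regular (R : pzRingType) : projective (R^o : lmodType R).
Proof.
move=> X Y g f gS; have [z zP] := gS (f 1).
have /linear_of[h hE] : linear (fun v : R^o => (v : R) *: z).
  by move=> a x y; rewrite scalerDl scalerA.
by exists h => v; rewrite hE linearZ /= zP -linearZ /= /GRing.scale /= mulr1.
Qed.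

Section FreeModule.
Variables (R : pzRingType) (X : choiceType).

Definition freemod : Type := {malg R[X]}.
HB.instance Definition _ := GRing.Zmodule.on freemod.

Definition fcoef (x : X) (f : freemod) : R := monalg.mcoeff x f.
Definition fbase (a : R) (x : X) : freemod := monalg.mkmalgU x a.

Lemma fcoefD x f g : fcoef x (f + g) = fcoef x f + fcoef x g.
Proof. exact: monalg.mcoeffD. Qed.
Lemma fcoef0 x : fcoef x 0 = 0.
Proof. exact: monalg.mcoeff0. Qed.
Lemma fcoefU a x y : fcoef y (fbase a x) = a *+ (x == y).
Proof. exact: monalg.mcoeffU. Qed.
Lemma freemodP f g : (forall x, fcoef x f = fcoef x g) -> f = g.
Proof. by move/monalg.malgP. Qed.
Lemma fcoef_sum (I : Type) (r : seq I) (F : I -> freemod) x :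
  fcoef x (\sum_(i <- r) F i) = \sum_(i <- r) fcoef x (F i).
Proof.
by elim: r => [|i r IH]; rewrite ?big_nil ?fcoef0 // !big_cons fcoefD IH.
Qed.

Definition freemod_map (S : pzRingType) (h : R -> S) (f : freemod) : {malg S[X]} :=
  \sum_(x <- monalg.msupp f) monalg.mkmalgU x (h (fcoef x f)).

Lemma fcoef_map (S : pzRingType) (h : R -> S) x f : h 0 = 0 ->
  monalg.mcoeff x (freemod_map h f) = h (fcoef x f).
Proof.
move=> h0; rewrite /freemod_map raddf_sum.
under eq_bigr do rewrite /= monalg.mcoeffU.
have [xf|xf] := boolP (x \in monalg.msupp f).
  rewrite (big_fsetD1 x) //= eqxx big1_fset ?addr0 // => y /fsetD1P[ne _] _.
  by rewrite (negPf ne).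
rewrite /fcoef (monalg.mcoeff_outdom xf) h0 big1_fset // => y yf _.
by case: eqP xf => // <-; rewrite yf.
Qed.

Definition fscale (a : R) (f : freemod) : freemod := freemod_map ( *%R a) f.

Lemma fcoef_scale a x f : fcoef x (fscale a f) = a * fcoef x f.
Proof. by apply: fcoef_map; rewrite mulr0. Qed.

Fact fscaleA a b f : fscale a (fscale b f) = fscale (a * b) f.
Proof. by apply: freemodP => x; rewrite !fcoef_scale mulrA. Qed.
Fact fscale1 : left_id 1 fscale.
Proof. by move=> f; apply: freemodP => x; rewrite fcoef_scale mul1r. Qed.
Fact fscaleDr : right_distributive fscale +%R.
Proof.
by move=> a f g; apply: freemodP => x; rewrite !(fcoef_scale, fcoefD) mulrDr.
Qed.
Fact fscaleDl f : {morph fscale^~ f : a b / a + b}.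
Proof.
by move=> a b; apply: freemodP => x; rewrite !(fcoef_scale, fcoefD) mulrDl.
Qed.
HB.instance Definition _ := GRing.Zmodule_isLmodule.Build R freemod
  fscaleA fscale1 fscaleDr fscaleDl.

Lemma fcoefZ a x (f : freemod) : fcoef x (a *: f) = a * fcoef x f.
Proof. exact: fcoef_scale. Qed.

Lemma freemodE (f : freemod) :
  f = \sum_(x <- monalg.msupp f) fcoef x f *: fbase 1 x.
Proof.
apply: freemodP => x; rewrite -[LHS](@fcoef_map _ id) // fcoef_sum raddf_sum.
apply: eq_bigr => y _; rewrite fcoefZ fcoefU /= monalg.mcoeffU.
by rewrite mulrnAr mulr1.
Qed.

Lemma freemod_ext (M : lmodType R) (h : X -> M) :
  exists g : {linear freemod -> M}, forall x, g (fbase 1 x) = h x.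
Proof.
pose ev (d : {fset X}) (f : freemod) := \sum_(x <- d) fcoef x f *: h x.
have evw (d : {fset X}) f : (monalg.msupp f `<=` d)%fset ->
    ev (monalg.msupp f) f = ev d f.
  move=> le; apply: (big_fset_incl _ le) => x _ xf.
  by rewrite /fcoef (monalg.mcoeff_outdom xf) scale0r.
have /linear_of[g gE] : linear (fun f : freemod => ev (monalg.msupp f) f).
  move=> a f1 f2.
  pose d := (monalg.msupp f1 `|` monalg.msupp f2 `|` monalg.msupp (a *: f1 + f2))%fset.
  rewrite (evw d) ?fsubsetUr // (evw d f1); last by rewrite /d -fsetUA fsubsetUl.
  rewrite (evw d f2); last by rewrite /d fsetUAC fsubsetUr.
  rewrite /ev scaler_sumr -big_split; apply: eq_bigr => x _.
  by rewrite fcoefD fcoefZ scalerDl scalerA.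
exists g => x; rewrite gE (evw [fset x]%fset) ?monalg.msuppU_le //.
by rewrite /ev big_seq_fset1 fcoefU eqxx scale1r.
Qed.

Lemma projective_freemod : projective (freemod : lmodType R).
Proof.
move=> M Y g f gS; have [z zP] := boolp.choice gS.
have [h hE] := freemod_ext (fun x => z (f (fbase 1 x))).
exists h => p; rewrite (freemodE p) !linear_sum; apply: eq_bigr => x _.
by rewrite !linearZ /= hE zP.
Qed.
End FreeModule.

(** With all elements of [M] as basis no generators have to be chosen, so that every module has a
    first syzygy. *)
Lemma free_cover (R : pzRingType) (M : lmodType R) :
  exists (N L : lmodType R) (u : {linear N -> L}) (v : {linear L -> M}),
    short_exact u v /\ projective L.
Proof.
have [v vE] := freemod_ext (id : M -> M).
have [|N [u uv]] := @short_exact_ker _ _ _ v; first by move=> y; exists (fbase 1 y).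
by exists N, (freemod R M : lmodType R), u, v; split=> //; exact: projective_freemod.
Qed.

(** * Dimensions of torsion products with the residue field *)

Section Torsion.
Variables (k : fieldType) (B : pzRingType).
Variables (eps : {rmorphism B -> k}) (sc : {rmorphism k -> B}).
Implicit Types (M N L : lmodType B^c) (c : k).

Definition submodule M (V : M -> Prop) : Prop :=
  V 0 /\ forall a x y, V x -> V y -> V (a *: x + y).

Lemma submoduleZ M (V : M -> Prop) a x : submodule V -> V x -> V (a *: x).
Proof. by move=> [V0 VP] Vx; rewrite -[a *: x]addr0; exact: VP. Qed.

Lemma submoduleD M (V : M -> Prop) x y : submodule V -> V x -> V y -> V (x + y).
Proof. by move=> [V0 VP] Vx Vy; rewrite -[x]scale1r; exact: VP. Qed.

Lemma submoduleB M (V : M -> Prop) x y : submodule V -> V x -> V y -> V (x - y).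
Proof. by move=> [V0 VP] Vx Vy; rewrite addrC -scaleN1r; exact: VP. Qed.

Lemma submodule_sum M (V : M -> Prop) (I : Type) (r : seq I) (F : I -> M) :
  submodule V -> (forall i, V (F i)) -> V (\sum_(i <- r) F i).
Proof.
move=> sV VF; elim: r => [|i r IH]; first by rewrite big_nil; case: sV.
by rewrite big_cons; exact: submoduleD.
Qed.

Definition lsc M c (x : M) : M := (sc c : B^c) *: x.

Lemma lscM M c1 c2 (x : M) : lsc c1 (lsc c2 x) = lsc (c1 * c2) x.
Proof. by rewrite /lsc scalerA mulrC rmorphM. Qed.
Lemma lsc_sumr M c (I : finType) (F : I -> M) :
  lsc c (\sum_i F i) = \sum_i lsc c (F i).
Proof. exact: scaler_sumr. Qed.
Lemma lsc_suml M (I : finType) (F : I -> k) (x : M) :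
  lsc (\sum_i F i) x = \sum_i lsc (F i) x.
Proof. by rewrite /lsc raddf_sum scaler_suml. Qed.

(* [U / V] is a [k]-space of dimension [d]. *)
Definition dimq M (U V : M -> Prop) (d : nat) : Prop :=
  exists e : 'I_d -> M, [/\ forall j, U (e j),
    forall x, U x -> exists l : 'I_d -> k, V (x - \sum_j lsc (l j) (e j))
    & forall l : 'I_d -> k, V (\sum_j lsc (l j) (e j)) -> forall j, l j = 0].

(** Expressing two bases of U / V through each other gives matrices whose product is the identity,
    because the first family is free; this bounds its size. *)
Lemma dimq_leq M (U V : M -> Prop) d d' : submodule V ->
  dimq U V d -> dimq U V d' -> (d <= d')%N.
Proof.
move=> sV [e [Ue es ef]] [e' [Ue' e's _]].
have [a aP] := boolp.choice (fun j => e's _ (Ue j)).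
have [b bP] := boolp.choice (fun j => es _ (Ue' j)).
apply: (@mulmx1_min k _ _ (\matrix_(j, i) a j i) (\matrix_(i, j) b i j)).
apply/matrixP => j l; rewrite !mxE; apply/eqP; rewrite eq_sym -subr_eq0; apply/eqP.
under eq_bigr do rewrite !mxE.
apply: (ef (fun l => (j == l)%:R - \sum_i a j i * b i l)).
have -> : \sum_l lsc ((j == l)%:R - \sum_i a j i * b i l) (e l) =
    (e j - \sum_i lsc (a j i) (e' i)) +
    \sum_i lsc (a j i) (e' i - \sum_l lsc (b i l) (e l)).
  have E c1 c2 (x : M) : lsc (c1 - c2) x = lsc c1 x - lsc c2 x.
    by rewrite /lsc rmorphB scalerBl.
  have E' c (x y : M) : lsc c (x - y) = lsc c x - lsc c y.
    by rewrite /lsc scalerBr.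
  under eq_bigr do rewrite E.
  rewrite [X in _ = _ + X](eq_bigr (fun i => lsc (a j i) (e' i) -
    \sum_l lsc (a j i) (lsc (b i l) (e l)))) => [|i _]; last by rewrite E' lsc_sumr.
  rewrite !sumrB addrA subrK; congr (_ - _).
    rewrite (bigD1 j) //= eqxx big1 => [|i /negPf ij].
      by rewrite addr0 /lsc rmorph1 scale1r.
    by rewrite eq_sym ij /lsc rmorph0 scale0r.
  rewrite exchange_big; apply: eq_bigr => i _.
  by rewrite lsc_suml; apply: eq_bigr => l' _; rewrite lscM.
apply: submoduleD => //; apply: submodule_sum => // i.
exact: submoduleZ.
Qed.

Lemma dimq_uniq M (U V : M -> Prop) d d' : submodule V ->
  dimq U V d -> dimq U V d' -> d = d'.
Proof.
move=> sV h h'; apply/eqP.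
by rewrite eqn_leq (dimq_leq sV h h') (dimq_leq sV h' h).
Qed.

(** The submodule M J for the kernel J of [eps]; M / M J is the tensor product of M with the residue
    field. *)
Definition inJ M (x : M) : Prop := exists2 l : seq (B * M),
  all (fun t => eps t.1 == 0) l & x = \sum_(t <- l) (t.1 : B^c) *: t.2.

Lemma inJ_scale M (b : B) (x : M) : eps b = 0 -> inJ ((b : B^c) *: x).
Proof.
by move=> b0; exists [:: (b, x)]; rewrite /= ?b0 ?eqxx // big_seq1.
Qed.

Lemma inJ_submodule M : submodule (@inJ M).
Proof.
split=> [|a x y [l la ->] [l' la' ->]]; first by exists [::]; rewrite ?big_nil.
exists ([seq (t.1 * (a : B), t.2) | t <- l] ++ l').
  rewrite all_cat la' andbT all_map; apply: sub_all la => t /= /eqP t0.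
  by rewrite rmorphM t0 mul0r.
rewrite big_cat big_map scaler_sumr; congr (_ + _).
by apply: eq_bigr => t _; rewrite scalerA.
Qed.

Lemma inJ_ind M (V : M -> Prop) : submodule V ->
  (forall b x, eps b = 0 -> V ((b : B^c) *: x)) -> forall x, inJ x -> V x.
Proof.
move=> sV VJ x [l la ->]; elim: l la => [|t l IH] /=.
  by rewrite big_nil; case: sV.
by case/andP=> /eqP t0 /IH Vl; rewrite big_cons; apply: submoduleD => //; exact: VJ.
Qed.

Lemma inJ_lin M N (f : {linear M -> N}) x : inJ x -> inJ (f x).
Proof.
apply: (inJ_ind (V := fun x => inJ (f x))).
  split=> [|a y z fy fz]; first by rewrite linear0; case: (inJ_submodule N).
  by rewrite linearP; case: (inJ_submodule N) => _; apply.
by move=> b y b0; rewrite linearZ; exact: inJ_scale.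
Qed.

Lemma inJ_preim_submodule N L (u : {linear N -> L}) :
  submodule (fun x => inJ (u x)).
Proof.
have [J0 JP] := inJ_submodule L.
by split=> [|a x y]; rewrite ?linear0 // linearP; exact: JP.
Qed.

(* Only meaningful for the inclusion [u] of a first syzygy of a module [M] in a
   projective module: then [d] is the dimension of Tor_1(M, k). *)
Definition tor1 N L (u : {linear N -> L}) d : Prop :=
  dimq (fun x => inJ (u x)) (@inJ N) d.

(* [tor i M d] says that Tor_i(M, k) has dimension [d]. *)
Fixpoint tor i M d : Prop :=
  if i is j.+1 then
    exists N L (u : {linear N -> L}) (v : {linear L -> M}),
      [/\ short_exact u v, projective L & if j is 0 then tor1 u d else tor j N d]
  else dimq (fun _ : M => True) (@inJ M) d.

End Torsion.

(** The hypotheses make [p] induce a bijection from U / V to U' / V'. Since [p] has to respect only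
    the scalars of k, this covers maps over one ring as well as reductions from one ring to
    another. *)
Lemma dimq_pull (k : fieldType) (B B' : pzRingType)
    (sc : {rmorphism k -> B}) (sc' : {rmorphism k -> B'})
    (M : lmodType B^c) (M' : lmodType B'^c) (p : {additive M -> M'})
    (U V : M -> Prop) (U' V' : M' -> Prop) d :
  (forall c x, p (lsc sc c x) = lsc sc' c (p x)) ->
  submodule U -> submodule V' ->
  (forall x, U x -> U' (p x)) -> (forall x, U x -> V x <-> V' (p x)) ->
  (forall y, U' y -> exists2 x, U x & V' (y - p x)) ->
  dimq sc' U' V' d -> dimq sc U V d.
Proof.
move=> pc sU sV' UU' VV' sur [e' [U'e' e's ef]].
have /boolp.choice[e eP] : forall j, exists x, U x /\ V' (e' j - p x).
  by move=> j; have [x Ux xP] := sur _ (U'e' j); exists x.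
have Us l : U (\sum_j lsc sc (l j) (e j)).
  by apply: submodule_sum => // j; apply: submoduleZ => //; case: (eP j).
have E l : V' (\sum_j lsc sc' (l j) (e' j) - p (\sum_j lsc sc (l j) (e j))).
  rewrite raddf_sum -sumrB; apply: submodule_sum => // j.
  by rewrite /= pc /lsc -scalerBr; apply: submoduleZ => //; case: (eP j).
exists e; split=> [j|x Ux|l /(VV' _ (Us l)) Vl]; first by case: (eP j).
  have [l lP] := e's _ (UU' _ Ux); exists l; apply/VV'.
    by apply: submoduleB.
  rewrite raddfB -(subrKA (\sum_j lsc sc' (l j) (e' j))).
  exact: submoduleD.
apply: ef; rewrite -[X in V' X](subrK (p (\sum_j lsc sc (l j) (e j)))).
exact: submoduleD.
Qed.

(** * Independence of Tor from the chosen syzygies *)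

Section TorTheory.
Variables (k : fieldType) (B : pzRingType).
Variables (eps : {rmorphism B -> k}) (sc : {rmorphism k -> B}).
Implicit Types (M N L Q : lmodType B^c) (c : k).

Lemma dimq_ext M (U V U' V' : M -> Prop) d :
  (forall x, U x <-> U' x) -> (forall x, V x <-> V' x) ->
  dimq sc U V d -> dimq sc U' V' d.
Proof.
move=> UU' VV' [e [Ue es ef]]; exists e; split=> [j|x /UU' Ux|l /VV'].
- exact/UU'.
- by have [l lP] := es _ Ux; exists l; exact/VV'.
- exact: ef.
Qed.

Lemma dimq_prod M M' (U V : M -> Prop) (U' V' : M' -> Prop) d d' :
  submodule U -> submodule U' ->
  dimq sc U V d -> dimq sc U' V' d' ->
  dimq sc (fun x : M * M' => U x.1 /\ U' x.2) (fun x => V x.1 /\ V' x.2) (d + d').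
Proof.
move=> [U0 _] [U'0 _] [e [Ue es ef]] [e' [Ue' es' ef']].
pose E (j : 'I_(d + d')) : M * M' :=
  match split j with inl i => (e i, 0) | inr i => (0, e' i) end.
have EL i : E (lshift d' i) = (e i, 0).
  by rewrite /E -[lshift _ _]/(unsplit (inl i)) unsplitK.
have ER i : E (rshift d i) = (0, e' i).
  by rewrite /E -[rshift _ _]/(unsplit (inr i)) unsplitK.
have S (l : 'I_(d + d') -> k) : \sum_j lsc sc (l j) (E j) =
    (\sum_j lsc sc (l (lshift d' j)) (e j), \sum_j lsc sc (l (rshift d j)) (e' j)).
  rewrite big_split_ord /=.
  rewrite (eq_bigr (fun i => (lsc sc (l (lshift d' i)) (e i), 0))) => [|i _]; last first.
    by rewrite EL; apply: injective_projections; rewrite /= ?scaler0.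
  rewrite [X in _ + X](eq_bigr (fun i => (0, lsc sc (l (rshift d i)) (e' i))))
    => [|i _]; last first.
    by rewrite ER; apply: injective_projections; rewrite /= ?scaler0.
  rewrite [LHS]surjective_pairing /= !raddf_sum; congr (_, _).
    by rewrite [X in _ + X]big1 ?addr0.
  by rewrite [X in X + _]big1 ?add0r.
exists E; split=> [j|[x x'] /= [/es[l lP] /es'[l' lP']]|l].
- by rewrite /E; case: (split j) => i /=; split.
- exists (fun j => match split j with inl i => l i | inr i => l' i end).
  rewrite S /=; split.
    by under eq_bigr do rewrite -[lshift _ _]/(unsplit (inl _)) unsplitK.
  by under eq_bigr do rewrite -[rshift _ _]/(unsplit (inr _)) unsplitK.
- rewrite S /= => -[/ef l0 /ef' l0'] j.
  by rewrite -(splitK j); case: (split j) => i; [exact: l0 | exact: l0'].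
Qed.

Lemma linear_inl M M' : exists i : {linear M -> (M * M')%type}, forall x, i x = (x, 0).
Proof.
have /linear_of[i iE] : linear (fun x : M => (x, 0 : M')); last by exists i.
by move=> a x y; apply: injective_projections; rewrite /= ?scaler0 ?addr0.
Qed.

Lemma linear_inr M M' : exists i : {linear M' -> (M * M')%type}, forall x, i x = (0, x).
Proof.
have /linear_of[i iE] : linear (fun x : M' => (0 : M, x)); last by exists i.
by move=> a x y; apply: injective_projections; rewrite /= ?scaler0 ?addr0.
Qed.

Lemma linear_prodmap M M' N N' (f : {linear M -> N}) (g : {linear M' -> N'}) :
  exists h : {linear (M * M')%type -> (N * N')%type}, forall x, h x = (f x.1, g x.2).
Proof.
have /linear_of[h hE] : linear (fun x : M * M' => (f x.1, g x.2)); last by exists h.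
by move=> a x y; apply: injective_projections; rewrite /= linearP.
Qed.

Lemma inJ_prod M M' (x : M) (x' : M') : inJ eps (x, x') <-> inJ eps x /\ inJ eps x'.
Proof.
split=> [xJ|[xJ xJ']].
  split; first exact: (inJ_lin (@fst M M' : {linear (M * M')%type -> M}) xJ).
  exact: (inJ_lin (@snd M M' : {linear (M * M')%type -> M'}) xJ).
have [i iE] := linear_inl M M'; have [j jE] := linear_inr M M'.
have -> : (x, x') = i x + j x'.
  by rewrite iE jE; apply: injective_projections; rewrite /= ?addr0 ?add0r.
by apply: submoduleD; [exact: inJ_submodule | exact: inJ_lin | exact: inJ_lin].
Qed.

Lemma submoduleT M : submodule (fun _ : M => True). Proof. by []. Qed.

Lemma tor_iso i M M' (f : {linear M -> M'}) d :
  injective f -> (forall y, exists x, f x = y) ->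
  tor eps sc i M d -> tor eps sc i M' d.
Proof.
move=> fI fS; case: i => [|i] /=; last first.
  move=> [N [L [u [v [[uI vS ve] pL H]]]]].
  exists N, L, u, (f \o v); split=> //; split=> // [y|x].
    by have [x <-] := fS y; have [z <-] := vS x; exists z.
  rewrite -ve /=; split=> [e|->]; last by rewrite linear0.
  by apply: fI; rewrite linear0.
have [g gP] := lift_mono (h := idfun) fI fS.
apply: (dimq_pull (p := g)) => // [c x|||y _].
- exact: (linearZ_LR g).
- exact: inJ_submodule.
- move=> x _; split; first exact: inJ_lin.
  by move/(inJ_lin f); rewrite gP.
- exists (f y) => //; rewrite -[X in inJ _ X]/(y - g (f y)).
  have -> : g (f y) = y by apply: fI; rewrite gP.
  by rewrite subrr; case: (inJ_submodule eps M).
Qed.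

(** The map id - g f sends L into the kernel N of [v], hence factors through some h' from L to N,
    and on N the difference id - g1 f1 is h' u. So it carries the elements of N that lie in L J into
    N J. *)
Lemma tor1_homotopy N L M N' L' (u : {linear N -> L}) (v : {linear L -> M})
    (u' : {linear N' -> L'}) (v' : {linear L' -> M})
    (f : {linear L -> L'}) (g : {linear L' -> L})
    (f1 : {linear N -> N'}) (g1 : {linear N' -> N}) :
  short_exact u v -> (forall x, v' (f x) = v x) -> (forall x, v (g x) = v' x) ->
  (forall x, u' (f1 x) = f (u x)) -> (forall x, u (g1 x) = g (u' x)) ->
  forall x, inJ eps (u x) -> inJ eps (x - g1 (f1 x)).
Proof.
move=> [uI vS ve] fv gv f1u g1u x ux.
have /linear_of[h hE] : linear (fun y => y - g (f y)).
  by move=> a y z; rewrite (linearP f) (linearP g) scalerBr opprD addrACA.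
have [|h' h'P] := lift_mono (h := h) uI.
  by move=> y; apply/ve; rewrite hE linearB gv fv subrr.
suff -> : x - g1 (f1 x) = h' (u x) by exact: inJ_lin.
by apply: uI; rewrite h'P hE linearB g1u f1u.
Qed.

Lemma tor1_transfer N L M N' L' (u : {linear N -> L}) (v : {linear L -> M})
    (u' : {linear N' -> L'}) (v' : {linear L' -> M}) d :
  short_exact u v -> short_exact u' v' -> projective L -> projective L' ->
  tor1 eps sc u d -> tor1 eps sc u' d.
Proof.
move=> uv uv' pL pL'; have [uI vS ve] := uv; have [uI' vS' ve'] := uv'.
have [f fv] := pL _ _ v' v vS'; have [g gv] := pL' _ _ v v' vS.
have [|f1 f1u] := lift_mono (h := f \o u) uI'.
  by move=> x; apply/ve'; rewrite /= fv; apply/ve; exists x.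
have [|g1 g1u] := lift_mono (h := g \o u') uI.
  by move=> x; apply/ve; rewrite /= gv; apply/ve'; exists x.
have fU x : inJ eps (u x) -> inJ eps (u' (f1 x)).
  by move=> ux; rewrite f1u; exact: (inJ_lin f ux).
have gU x : inJ eps (u' x) -> inJ eps (u (g1 x)).
  by move=> ux; rewrite g1u; exact: (inJ_lin g ux).
have sJ := @inJ_submodule k B eps.
apply: (dimq_pull (p := g1)) => // [c x||x|y uy].
- exact: (linearZ_LR g1).
- exact: inJ_preim_submodule.
- move=> ux; split; first exact: inJ_lin.
  move/(inJ_lin f1) => H; rewrite -(subrK (f1 (g1 x)) x).
  by apply: submoduleD => //; exact: (tor1_homotopy uv' gv fv g1u f1u).
- exists (f1 y); first exact: fU.
  exact: (tor1_homotopy uv fv gv f1u g1u).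
Qed.

(** Schanuel's lemma: a pair (x, y) is sent to u x + g y in L, together with the element of N' that
    measures how far [f] is from sending this back to y. *)
Lemma schanuel N L M N' L' (u : {linear N -> L}) (v : {linear L -> M})
    (u' : {linear N' -> L'}) (v' : {linear L' -> M}) :
  short_exact u v -> short_exact u' v' -> projective L -> projective L' ->
  exists f : {linear (N * L')%type -> (N' * L)%type},
    injective f /\ forall y, exists x, f x = y.
Proof.
move=> [uI vS ve] [uI' vS' ve'] pL pL'.
have [f fv] := pL _ _ v' v vS'; have [g gv] := pL' _ _ v v' vS.
have vu x : v (u x) = 0 by apply/ve; exists x.
have vu' x : v' (u' x) = 0 by apply/ve'; exists x.
have /linear_of[h hE] : linear (fun x : N * L' => u x.1 + g x.2).
  by move=> a x y; rewrite !linearP /= scalerDr addrACA.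
have /linear_of[h2 h2E] : linear (fun x : N * L' => x.2 - f (h x)).
  by move=> a x y; rewrite (linearP h) (linearP f) /= scalerBr opprD addrACA.
have [|h' h'P] := lift_mono (h := h2) uI'.
  by move=> x; apply/ve'; rewrite h2E linearB fv hE linearD vu gv add0r subrr.
have /linear_of[F FE] : linear (fun x : N * L' => (h' x, h x)).
  by move=> a x y; rewrite (linearP h) (linearP h').
have hx x : x.2 = f (h x) + u' (h' x) by rewrite h'P h2E addrC subrK.
exists F; split.
  suff F0 x : F x = 0 -> x = 0.
    move=> x y e; apply/eqP; rewrite -subr_eq0; apply/eqP/F0.
    by rewrite linearB /= e subrr.
  rewrite FE => -[h'0 h0].
  have x2 : x.2 = 0 by rewrite hx h0 h'0 !linear0 addr0.
  apply: injective_projections => //; apply: uI.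
  by move: h0; rewrite hE x2 !linear0 addr0.
move=> [y z]; pose l' := u' y + f z.
have [n nP] : exists n, u n = z - g l'.
  by apply/ve; rewrite linearB gv linearD vu' fv add0r subrr.
exists (n, l'); rewrite FE.
have hz : h (n, l') = z by rewrite hE /= nP subrK.
congr (_, _) => //; apply: uI'; rewrite h'P h2E hz /=.
by rewrite /l' addrK.
Qed.

Lemma short_exact_addproj N L M Q (u : {linear N -> L}) (v : {linear L -> M}) :
  short_exact u v -> exists (u' : {linear N -> (L * Q)%type})
    (v' : {linear (L * Q)%type -> (M * Q)%type}),
    short_exact u' v' /\ forall x, u' x = (u x, 0).
Proof.
move=> [uI vS ve]; have [i iE] := linear_inl L Q.
have [v' vE] := linear_prodmap v (idfun : {linear Q -> Q}).
exists (i \o u), v'; split=> [|x]; last by rewrite /= iE.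
split=> [x y /=|[y z]|[x z]].
- by rewrite !iE => -[/uI].
- by have [x <-] := vS y; exists (x, z); rewrite vE.
rewrite vE /=; split=> [[/ve[y <-] ->]|[y]]; first by exists y; rewrite iE.
by rewrite iE => -[<- <-]; congr (_, _); apply/ve; exists y.
Qed.

Lemma tor1_addproj N L Q (u : {linear N -> L}) (u' : {linear N -> (L * Q)%type}) d :
  (forall x, u' x = (u x, 0)) -> tor1 eps sc u d <-> tor1 eps sc u' d.
Proof.
move=> uE; have E x : inJ eps (u x) <-> inJ eps (u' x).
  rewrite uE inJ_prod; split=> [H|[]//]; split=> //.
  by case: (inJ_submodule eps Q).
by split; apply: dimq_ext => // x; symmetry.
Qed.

Lemma tor_addproj i M Q d : projective Q ->
  tor eps sc i.+1 M d -> tor eps sc i.+1 (M * Q)%type d.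
Proof.
move=> pQ [N [L [u [v [uv pL H]]]]].
have [u' [v' [uv' uE]]] := short_exact_addproj Q uv.
exists N, (L * Q)%type, u', v'; split=> //; first exact: projective_prod.
by case: i H => // H; apply/(tor1_addproj _ uE).
Qed.

(** By Schanuel's lemma two syzygies agree up to projective summands, which do not affect Tor in
    positive degrees. The summand [L'] next to N is removed by the induction hypothesis, applied to
    a syzygy of N that also serves N x L'. *)
Lemma tor_short_exact i M d : tor eps sc i.+1 M d ->
  forall N L (u : {linear N -> L}) (v : {linear L -> M}),
  short_exact u v -> projective L ->
  if i is 0 then tor1 eps sc u d else tor eps sc i N d.
Proof.
elim: i M d => [|i IH] M d [N' [L' [u' [v' [uv' pL' H]]]]] N L u v uv pL.
  exact: (tor1_transfer uv' uv).
have [F [FI FS]] := schanuel uv' uv pL' pL.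
have {}H := tor_iso FI FS (tor_addproj pL H).
have [N2 [L2 [u2 [v2 [uv2 pL2]]]]] := free_cover N.
have [u3 [v3 [uv3 uE]]] := short_exact_addproj L' uv2.
have {}H := IH _ _ H _ _ _ _ uv3 (projective_prod pL2 pL').
exists N2, L2, u2, v2; split=> //.
by case: i {IH} H => // H; apply/(tor1_addproj _ uE).
Qed.

Lemma tor_uniq i M d d' : tor eps sc i M d -> tor eps sc i M d' -> d = d'.
Proof.
elim: i M => [|i IH] M.
  exact/dimq_uniq/inJ_submodule.
move=> [N [L [u [v [uv pL H]]]]] /tor_short_exact/(_ _ _ _ _ uv pL).
by case: i IH H => [_|i IH]; [exact/dimq_uniq/inJ_submodule | exact: IH].
Qed.

Lemma tor_prod i M M' d d' : tor eps sc i M d -> tor eps sc i M' d' ->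
  tor eps sc i (M * M')%type (d + d').
Proof.
elim: i M M' => [|i IH] M M'.
  move=> /(dimq_prod (@submoduleT _) (@submoduleT _)) H /H /=.
  by apply: dimq_ext => // -[x y]; rewrite inJ_prod.
move=> [N [L [u [v [uv pL H]]]]] [N' [L' [u' [v' [uv' pL' H']]]]].
have [uI vS ve] := uv; have [uI' vS' ve'] := uv'.
have [U UE] := linear_prodmap u u'; have [V VE] := linear_prodmap v v'.
exists (N * N')%type, (L * L')%type, U, V; split; last 1 first.
- case: i IH H H' => [_|i IH]; last exact: IH.
  move=> /(dimq_prod (inJ_preim_submodule _ u) (inJ_preim_submodule _ u')) H /H.
  by apply: dimq_ext => -[x y] /=; rewrite ?UE ?inJ_prod.
- split=> [[x x'] [y y']|[y y']|[x x']].
  + by rewrite !UE => -[/uI-> /uI'->].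
  + have [x <-] := vS y; have [x' <-] := vS' y'.
    by exists (x, x'); rewrite VE.
  rewrite VE /=; split=> [[/ve[y <-] /ve'[y' <-]]|[[y y']]].
    by exists (y, y'); rewrite UE.
  rewrite UE => -[<- <-]; congr (_, _); first by apply/ve; exists y.
  by apply/ve'; exists y'.
- exact: projective_prod.
Qed.

Lemma tor_eps_ext (eps' : {rmorphism B -> k}) i M d : eps =1 eps' ->
  tor eps sc i M d -> tor eps' sc i M d.
Proof.
move=> e; have JE N (x : N) : inJ eps x <-> inJ eps' x.
  by split=> -[l la ->]; exists l => //; apply: sub_all la => t; rewrite e.
elim: i M => [|i IH] M; first exact: dimq_ext.
move=> [N [L [u [v [uv pL H]]]]]; exists N, L, u, v; split=> //.
by case: i IH H => [_|i IH]; [exact: dimq_ext | exact: IH].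
Qed.
End TorTheory.

Lemma additive_of (U V : zmodType) (f : U -> V) :
  {morph f : x y / x - y} -> exists g : {additive U -> V}, g =1 f.
Proof.
move=> H; pose m := GRing.isZmodMorphism.Build _ _ f H.
by pose F : {additive U -> V} := HB.pack f m; exists F.
Qed.

(** * Minimal resolutions compute Tor *)

Section Resolution.
Variables (k : fieldType) (B : pzRingType).
Variables (eps : {rmorphism B -> k}) (sc : {rmorphism k -> B}).
Hypothesis scK : forall c, eps (sc c) = c.

Lemma inJ_cV b (v : 'cV[B^c]_b) : inJ eps v <-> forall j, eps (v j 0) = 0.
Proof.
split=> [|vJ].
  apply: (inJ_ind (V := fun v : 'cV[B^c]_b => forall j, eps (v j 0) = 0)).
    split=> [j|a x y xJ yJ j]; first by rewrite mxE rmorph0.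
    by rewrite !mxE rmorphD yJ addr0 [eps _](rmorphM eps) xJ mul0r.
  by move=> c x c0 j; rewrite mxE [eps _](rmorphM eps) c0 mulr0.
rewrite [v]matrix_sum_delta; apply: submodule_sum; first exact: inJ_submodule.
by move=> i; rewrite big_ord1; exact: inJ_scale.
Qed.

(** The induction drops the first term of the resolution and replaces [M] by the kernel of [aug],
    which the next differential covers. *)
Lemma tor_resolution i (b : nat -> nat) (M : lmodType B^c)
    (aug : {linear 'cV[B^c]_(b 0%N) -> M})
    (d : forall i, {linear 'cV[B^c]_(b i.+1) -> 'cV[B^c]_(b i)}) :
  (forall x, exists v, aug v = x) ->
  (forall v, aug v = 0 <-> exists w, d 0%N w = v) ->
  (forall i v, d i v = 0 <-> exists w, d i.+1 w = v) ->
  (forall i w j, eps (d i w j 0) = 0) ->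
  tor eps sc i M (b i).
Proof.
elim: i b M aug d => [|i IH] b M aug d augS augE dE dJ.
  pose e j : M := aug (delta_mx j 0).
  have eE (l : 'I_(b 0%N) -> k) :
      \sum_j lsc sc (l j) (e j) = aug (\col_j (sc (l j) : B^c)).
    rewrite [X in aug X]matrix_sum_delta linear_sum; apply: eq_bigr => j _.
    by rewrite big_ord1 mxE [in RHS]linearZ.
  exists e; split=> // [x _|l].
    have [v <-] := augS x; exists (fun j => eps (v j 0)).
    rewrite eE -linearB; apply: inJ_lin; apply/inJ_cV => j.
    by rewrite !mxE rmorphB scK subrr.
  rewrite eE => H.
  suff [w [wJ wv]] : exists w : 'cV[B^c]_(b 0%N),
      inJ eps w /\ aug w = aug (\col_j (sc (l j) : B^c)).
    have /augE[z zE] : aug (\col_j (sc (l j) : B^c) - w) = 0 by rewrite linearB wv subrr.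
    move=> j; have := dJ 0%N z j; move/inJ_cV: wJ => /(_ j).
    by rewrite zE !mxE rmorphB scK => ->; rewrite subr0.
  move: H; apply: (inJ_ind (V := fun x => exists w, inJ eps w /\ aug w = x)).
    have sJ := inJ_submodule eps ('cV[B^c]_(b 0%N)).
    split=> [|a x y [w [wJ <-]] [w' [wJ' <-]]].
      by exists 0; split; [case: sJ | rewrite linear0].
    exists (a *: w + w'); split; last by rewrite linearP.
    by case: sJ => _; exact.
  move=> c x c0; have [v <-] := augS x.
  by exists ((c : B^c) *: v); split; [exact: inJ_scale | rewrite linearZ].
have [N [u uaug]] := short_exact_ker augS; have [uI _ uE] := uaug.
have [|aug' augP] := lift_mono (h := d 0%N) uI.
  by move=> w; apply/uE/augE; exists w.
have H : tor eps sc i N (b i.+1).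
  apply: (IH (fun i => b i.+1) N aug' (fun i => d i.+1)) => // [x|v].
    have /uE/augE[w wE] : exists z, u z = u x by exists x.
    by exists w; apply: uI; rewrite augP.
  rewrite -dE -augP; split=> [->|e]; first by rewrite linear0.
  by apply: uI; rewrite e linear0.
exists N, ('cV[B^c]_(b 0%N)), u, aug; split=> //; first exact: projective_cV.
(* By minimality the kernel of [aug] lies in J times the free module, so the condition that cuts out
   Tor_1 holds on all of it. *)
case: i IH H => // IH; apply: dimq_ext => // x; split=> // _.
have /uE/augE[w <-] : exists z, u z = u x by exists x.
by apply/inJ_cV => j; exact: dJ.
Qed.

Lemma tor_min_graded_resolution (gr : int -> B -> Prop) (irr : {pred B})
    (M : lmodType B^c) (grM : int -> M -> Prop)
    (F : min_graded_resolution gr irr grM) i :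
  (forall x, x \in irr -> eps x = 0) -> tor eps sc i M (res_rank F i).
Proof.
move=> irrJ; apply: (@tor_resolution i (res_rank F) M (res_aug F)
  (fun i => res_diff F i)).
- exact: res_aug_surj.
- exact: res_aug_exact.
- exact: res_diff_exact.
- by move=> j w l; apply/irrJ/res_minimal.
Qed.

Section ResidueField.
Variables (K : lmodType B^c) (e : {linear (B^c)^o -> K}).
Hypotheses (eS : forall x, exists b, e b = x)
           (eJ : forall b : B, e b = 0 <-> eps b = 0).

Lemma tor0_resfield : tor eps sc 0 K 1.
Proof.
have lE c : lsc sc c (e 1) = e (sc c).
  by rewrite /lsc -linearZ /= /GRing.scale /= mulr1.
exists (fun=> e 1); split=> // [x _|l].
  have [b <-] := eS x; exists (fun=> eps b); rewrite big_ord1 lE -linearB.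
  have -> : e (b - sc (eps b)) = 0 by apply/eJ; rewrite rmorphB scK subrr.
  by case: (inJ_submodule eps K).
rewrite big_ord1 lE => H j; rewrite ord1 -[LHS]scK; apply/eJ.
move: H; apply: (inJ_ind (V := fun x => x = 0)).
  by split=> // a x y -> ->; rewrite scaler0 addr0.
move=> b x b0; have [b' <-] := eS x; rewrite -linearZ; apply/eJ.
by rewrite /= /GRing.scale /= rmorphM b0 mulr0.
Qed.

Lemma inJ_regular (x : (B^c)^o) : eps x = 0 -> inJ eps x.
Proof.
move=> x0; have -> : x = (x : B^c) *: (1 : (B^c)^o) by rewrite /GRing.scale /= mulr1.
exact: inJ_scale.
Qed.

Lemma tor1_resfield (N : lmodType B^c) (u : {linear N -> (B^c)^o}) d :
  short_exact u e -> tor1 eps sc u d <-> tor eps sc 0 N d.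
Proof.
move=> [uI _ uE]; have uJ x : inJ eps (u x).
  by apply: inJ_regular; apply/eJ/uE; exists x.
by split; apply: dimq_ext => // x; split.
Qed.
End ResidueField.
End Resolution.

(** * Reduction modulo a regular normal element *)

Section BaseChange.
Variables (k : fieldType) (B B' : pzRingType).
Variables (eps : {rmorphism B -> k}) (sc : {rmorphism k -> B}).
Variables (eps' : {rmorphism B' -> k}) (sc' : {rmorphism k -> B'}).
Variables (th : {rmorphism B -> B'}) (c : B).
(** Normality of [c] is contained in [thK]: the left multiples of [c] form the kernel of a ring
    morphism, hence a two-sided ideal, and M c is a submodule of any right module M. *)
Hypotheses (thS : forall y, exists x, th x = y)
  (theps : forall x, eps' (th x) = eps x) (thsc : forall a, th (sc a) = sc' a)
  (thK : forall b, th b = 0 <-> exists x, b = x * c)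
  (creg : forall b, b * c = 0 -> b = 0).

(* [p] exhibits [M'] as M / Mc, and [c] is a nonzerodivisor on [M]. *)
Definition reduction (M : lmodType B^c) (M' : lmodType B'^c) (p : {additive M -> M'}) :=
  [/\ forall (b : B) x, p ((b : B^c) *: x) = (th b : B'^c) *: p x,
      forall y, exists x, p x = y,
      forall x, p x = 0 <-> exists y, x = (c : B^c) *: y
    & forall x, (c : B^c) *: x = 0 -> x = 0 :> M].

Lemma th_c : th c = 0. Proof. by apply/thK; exists 1; rewrite mul1r. Qed.
Lemma eps_c : eps c = 0. Proof. by rewrite -theps th_c rmorph0. Qed.

Lemma inJ_reduction (M : lmodType B^c) (M' : lmodType B'^c) (p : {additive M -> M'}) : reduction p ->
  forall x, inJ eps x <-> inJ eps' (p x).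
Proof.
move=> [pZ pS pK preg] x; split.
  apply: (inJ_ind (V := fun x => inJ eps' (p x))).
    split=> [|a y z yJ zJ]; first by rewrite raddf0; case: (inJ_submodule eps' M').
    by rewrite raddfD pZ; case: (inJ_submodule eps' M') => _; apply.
  by move=> b y b0; rewrite pZ; apply: inJ_scale; rewrite theps.
move=> pxJ; suff [z [zJ zE]] : exists z, inJ eps z /\ p z = p x.
  have /pK[y yE] : p (x - z) = 0 by rewrite raddfB zE subrr.
  rewrite -(subrK z x) yE; apply: submoduleD => //; first exact: inJ_submodule.
  exact/inJ_scale/eps_c.
move: pxJ; apply: (inJ_ind (V := fun y => exists z, inJ eps z /\ p z = y)).
  split=> [|a y y' [z [zJ <-]] [z' [zJ' <-]]].
    by exists 0; split; [case: (inJ_submodule eps M) | rewrite raddf0].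
  have [b <-] := thS a; exists ((b : B^c) *: z + z'); rewrite raddfD pZ; split=> //.
  by case: (inJ_submodule eps M) => _; exact.
move=> b' y b'0; have [b bE] := thS b'; have [z <-] := pS y.
exists ((b : B^c) *: z); rewrite pZ bE; split=> //.
by apply: inJ_scale; rewrite -theps bE.
Qed.

(** Both free modules have the underlying set of [M] as basis, so reducing coefficients is
    compatible with [p]. The induced map of syzygies has kernel exactly N c because [c] is regular
    on [M], that is, Tor_1(M, B / c) vanishes. *)
Lemma reduction_syzygy (M : lmodType B^c) (M' : lmodType B'^c)
    (p : {additive M -> M'}) : reduction p ->
  exists (N L : lmodType B^c) (u : {linear N -> L}) (v : {linear L -> M})
    (N' L' : lmodType B'^c) (u' : {linear N' -> L'}) (v' : {linear L' -> M'})
    (pN : {additive N -> N'}) (pL : {additive L -> L'}),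
  [/\ [/\ short_exact u v, projective L, short_exact u' v' & projective L'],
      reduction pN, reduction pL & forall x, u' (pN x) = pL (u x)].
Proof.
move=> [pZ pS pK preg].
pose L : lmodType B^c := freemod B^c M; pose L' : lmodType B'^c := freemod B'^c M.
have [v vE] := freemod_ext (id : M -> M); have [v' v'E] := freemod_ext (p : M -> M').
have vS y : exists x, v x = y by exists (fbase 1 y).
have v'S y : exists x, v' x = y by have [x <-] := pS y; exists (fbase 1 x).
have [N [u uv]] := short_exact_ker vS; have [N' [u' uv']] := short_exact_ker v'S.
have [uI _ uE] := uv; have [u'I _ u'E] := uv'.
have cm x (f : L) : fcoef x (freemod_map th f : L') = th (fcoef x f).
  by apply: fcoef_map; rewrite rmorph0.
have [pL pLE] : exists pL : {additive L -> L'}, pL =1 freemod_map th.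
  apply: additive_of => f g; apply: freemodP => x.
  by rewrite -scaleN1r -[in RHS]scaleN1r !(cm, fcoefD, fcoefZ) rmorphD rmorphM rmorphN1.
have cL x f : fcoef x (pL f) = th (fcoef x f) by rewrite pLE cm.
have pLZ (b : B) (f : L) : pL ((b : B^c) *: f) = (th b : B'^c) *: pL f.
  by apply: freemodP => x; rewrite !(cL, fcoefZ) [th _](rmorphM th).
have rL : reduction pL.
  split=> // [y|f|f].
  - have [s sP] := boolp.choice thS.
    exists (\sum_(x <- monalg.msupp y) (s (fcoef x y) : B^c) *: fbase 1 x).
    apply: freemodP => x; rewrite cL [in RHS](freemodE y) !fcoef_sum rmorph_sum.
    apply: eq_bigr => z _; rewrite !(fcoefZ, fcoefU) [LHS](rmorphM th) sP.
    by rewrite rmorphMn rmorph1.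
  - split=> [f0|[g ->]]; last by rewrite pLZ th_c scale0r.
    have /boolp.choice[s sP] b : exists x, th b = 0 -> b = x * c.
      case: (boolp.EM (th b = 0)) => [/thK[x ->]|nb]; first by exists x.
      by exists 0.
    exists (\sum_(x <- monalg.msupp f) (s (fcoef x f) : B^c) *: fbase 1 x).
    rewrite [LHS]freemodE scaler_sumr; apply: eq_bigr => x _.
    rewrite scalerA [X in X *: _](sP (fcoef x f)) //.
    by rewrite -cL f0 fcoef0.
  - move=> f0; apply: freemodP => x; rewrite fcoef0; apply: creg.
    by rewrite -[LHS]/((c : B^c) * fcoef x f) -fcoefZ f0 fcoef0.
have pv f : v' (pL f) = p (v f).
  rewrite (freemodE f) !raddf_sum; apply: eq_bigr => x _ /=.
  rewrite pLZ !linearZ /= vE pZ; congr (_ *: _).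
  suff -> : pL (fbase 1 x) = fbase 1 x by rewrite v'E.
  by apply: freemodP => y; rewrite cL !fcoefU rmorphMn rmorph1.
have /boolp.choice[q qP] x : exists y, u' y = pL (u x).
  apply/u'E; rewrite pv; have /uE-> : exists z, u z = u x by exists x.
  by rewrite raddf0.
have [pN pNE] : exists pN : {additive N -> N'}, pN =1 q.
  by apply: additive_of => x y; apply: u'I; rewrite linearB !qP raddfB /= raddfB.
have pNu x : u' (pN x) = pL (u x) by rewrite pNE qP.
exists N, L, u, v, N', L', u', v', pN, pL; split=> //.
  by split=> //; exact: projective_freemod.
have [_ pLS pLK pLreg] := rL; split=> [b x|y|x|x].
- by apply: u'I; rewrite linearZ !pNu linearZ pLZ.
- have [l lE] := pLS (u' y).
  (* The lift [l] lies in the syzygy only up to a multiple of [c], since [v l] is such a multiple;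
     subtracting it leaves the reduction unchanged. *)
  have /pK[m mE] : p (v l) = 0 by rewrite -pv lE; apply/u'E; exists y.
  have [l1 l1E] := vS m.
  have [n nE] : exists n, u n = l - (c : B^c) *: l1.
    by apply/uE; rewrite linearB linearZ l1E mE subrr.
  exists n; apply: u'I; rewrite pNu nE raddfB /= lE.
  by rewrite pLZ th_c scale0r subr0.
- split=> [x0|[y ->]]; last first.
    by apply: u'I; rewrite pNu linear0; apply/pLK; exists (u y); rewrite linearZ.
  have /pLK[l lE] : pL (u x) = 0 by rewrite -pNu x0 linear0.
  have /uE[y yE] : v l = 0.
    by apply: preg; rewrite -linearZ -lE; apply/uE; exists x.
  by exists y; apply: uI; rewrite linearZ /= yE.
- move=> x0; apply: uI; rewrite linear0; apply: pLreg.
  by rewrite -linearZ x0 linear0.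
Qed.

(** Syzygies of [M] and [M'] can be taken in parallel, one reducing to the other; and as M J
    contains M c, the quotients M / M J and M' / M' J' agree. *)
Lemma tor_reduction i (M : lmodType B^c) (M' : lmodType B'^c)
    (p : {additive M -> M'}) d : reduction p ->
  tor eps' sc' i M' d -> tor eps sc i M d.
Proof.
elim: i M M' p => [|i IH] M M' p rp; have [pZ pS pK preg] := rp.
  apply: (dimq_pull (p := p)) => // [a x||x _|y _].
  - by rewrite /lsc pZ thsc.
  - exact: inJ_submodule.
  - exact: inJ_reduction.
  - by have [x <-] := pS y; exists x; rewrite ?subrr //; case: (inJ_submodule eps' M').
have [N [L [u [v [N' [L' [u' [v' [pN [pL [[uv qL uv' qL'] rN rL pu]]]]]]]]]]] :=
  reduction_syzygy rp.
move=> /tor_short_exact/(_ _ _ _ _ uv' qL') H.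
exists N, L, u, v; split=> //; case: i IH H => [_|i IH]; last exact: (IH _ _ pN).
have [qZ qS qK qreg] := rN.
apply: (dimq_pull (p := pN)) => // [a x|||x|x _|y yJ].
- by rewrite /lsc qZ thsc.
- exact: inJ_preim_submodule.
- exact: inJ_submodule.
- by rewrite pu => H; apply/(inJ_reduction rL).
- exact: inJ_reduction.
- have [x xE] := qS y; exists x; last first.
    by rewrite xE subrr; case: (inJ_submodule eps' N').
  by apply/(inJ_reduction rL); rewrite -pu xE.
Qed.

Section ResidueField.
Hypotheses (scK : forall a, eps (sc a) = a) (scK' : forall a, eps' (sc' a) = a).
Variables (psi : {additive B -> k}).
Hypotheses (psiM : forall j b, eps j = 0 -> psi (j * b) = psi j * eps b)
           (psic : forall x, psi (x * c) = eps x).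
Variables (K : lmodType B^c) (e : {linear (B^c)^o -> K}).
Hypotheses (eS : forall x, exists b, e b = x)
           (eJ : forall b : B, e b = 0 <-> eps b = 0).
Variables (K' : lmodType B'^c) (e' : {linear (B'^c)^o -> K'}).
Hypotheses (eS' : forall x, exists b, e' b = x)
           (eJ' : forall b : B', e' b = 0 <-> eps' b = 0).

(* As [c] is not in the square of the maximal ideal J, which [psi] witnesses,
   J / Jc is the direct sum of the residue field and of the image of J. *)
Lemma reduction_irrelevant (N : lmodType B^c) (u : {linear N -> (B^c)^o})
    (N' : lmodType B'^c) (u' : {linear N' -> (B'^c)^o}) :
  short_exact u e -> short_exact u' e' ->
  exists p : {additive N -> (K' * N')%type}, reduction p.
Proof.
move=> [uI _ uE] [u'I _ u'E].
have uJ x : eps (u x) = 0 by apply/eJ/uE; exists x.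
have lE a : lsc sc' a (e' 1) = e' (sc' a).
  by rewrite /lsc -linearZ /= /GRing.scale /= mulr1.
have /boolp.choice[q qP] x : exists y, u' y = th (u x).
  by apply/u'E/eJ'; rewrite theps.
have uZ (b : B) x : u ((b : B^c) *: x) = (u x : B) * b by rewrite linearZ.
have [p pE] : exists p : {additive N -> (K' * N')%type},
    forall x, p x = (e' (sc' (psi (u x))), q x).
  apply: additive_of => x y; congr (_, _).
    by rewrite (linearB u) (raddfB psi) (rmorphB sc') (linearB e').
  by apply: u'I; rewrite (linearB u') !qP (linearB u) (rmorphB th).
exists p; split=> [b x|[y y']|x|x].
- rewrite !pE uZ psiM //; congr (_, _).
    rewrite /= -linearZ; apply/eqP; rewrite -subr_eq0 -linearB; apply/eqP/eJ'.
    by rewrite rmorphB [X in _ - X](rmorphM eps') !scK' theps subrr.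
  by apply: u'I; rewrite linearZ !qP uZ rmorphM.
- have [z <-] := eS' y; have [b bE] := thS (u' y').
  have b0 : eps b = 0 by rewrite -theps bE; apply/eJ'/u'E; exists y'.
  (* Adding [sc t * c] to [b] shifts [psi] by [t] and does not change the image under [th]. *)
  pose t := eps' z - psi b.
  have /uE[x xE] : e (b + sc t * c) = 0.
    by apply/eJ; rewrite rmorphD rmorphM eps_c mulr0 addr0.
  exists x; rewrite pE xE raddfD /= psic scK /t addrC subrK; congr (_, _).
    by apply/eqP; rewrite -subr_eq0 -linearB; apply/eqP/eJ'; rewrite rmorphB scK' subrr.
  by apply: u'I; rewrite qP xE rmorphD rmorphM th_c mulr0 addr0.
- rewrite pE; split=> [[/eJ' + q0]|[y ->]].
    rewrite scK' => psi0; have /thK[b bE] : th (u x) = 0 by rewrite -qP q0 linear0.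
    have /eJ/uE[y yE] : eps b = 0 by rewrite -psic -bE.
    by exists y; apply: uI; rewrite uZ yE.
  rewrite uZ psic uJ rmorph0 linear0; congr (_, _).
  by apply: u'I; rewrite qP uZ rmorphM th_c mulr0 linear0.
- move=> x0; apply: uI; rewrite linear0; apply: creg.
  by rewrite -uZ x0 linear0.
Qed.

(** Tor_(j+1) of [K] is Tor_j of the maximal ideal N. This ideal reduces to the direct sum of [K']
    and N', which contribute Tor_j and Tor_(j+1) of [K']. *)
Lemma tor_resfield_step (b : nat -> nat) :
  (forall i, tor eps' sc' i K' (b i)) ->
  forall i, tor eps sc i K (if i is j.+1 then b j + b j.+1 else b 0)%N.
Proof.
move=> Hb; case=> [|i].
  suff -> : b 0%N = 1%N by exact: tor0_resfield eS eJ.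
  by apply: tor_uniq (Hb 0%N) _; exact: tor0_resfield eS' eJ'.
have [N [u ue]] := short_exact_ker eS; have [N' [u' ue']] := short_exact_ker eS'.
have [p rp] := reduction_irrelevant ue ue'.
have H' : tor eps' sc' i N' (b i.+1).
  have /tor_short_exact/(_ _ _ _ _ ue' (@projective_regular _)) := Hb i.+1.
  by case: (i) => // H; apply/(tor1_resfield sc' eJ' _ ue').
have H := tor_reduction rp (tor_prod (Hb i) H').
exists N, (B^c)^o, u, e; split=> //; first exact: projective_regular.
by case: (i) H => // H; apply/(tor1_resfield sc eJ _ ue).
Qed.
End ResidueField.
End BaseChange.

(** * Homomorphisms out of a skew polynomial ring *)

Lemma skew_commX (k : fieldType) (E : algType k) (x y : E) (c : k) a b :
  x * y = c *: (y * x) -> x ^+ a * y ^+ b = c ^+ (a * b) *: (y ^+ b * x ^+ a).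
Proof.
move=> xy; have H d : x * y ^+ d = c ^+ d *: (y ^+ d * x).
  elim: d => [|d IH]; first by rewrite !expr0 scale1r mulr1 mul1r.
  rewrite [y ^+ d.+1]exprSr mulrA IH -scalerAl -[_ * x * y]mulrA xy -scalerAr.
  by rewrite scalerA mulrA -!exprSr.
elim: a => [|a IH]; first by rewrite mul0n !expr0 scale1r mulr1 mul1r.
rewrite exprS -mulrA IH -scalerAr [x * (_ * _)]mulrA H -scalerAl scalerA.
by rewrite -exprD mulSn addnC mulrA.
Qed.

Lemma skew_prodM (k : fieldType) (E : algType k) (y : nat -> E)
    (Q : nat -> nat -> k) (a b : nat -> nat) d :
  (forall i j, (j < i < d)%N -> y i * y j = Q i j *: (y j * y i)) ->
  (\prod_(0 <= i < d) y i ^+ a i) * (\prod_(0 <= i < d) y i ^+ b i) =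
  (\prod_(0 <= i < d) \prod_(0 <= j < i) Q i j ^+ (a i * b j)) *:
    \prod_(0 <= i < d) y i ^+ (a i + b i).
Proof.
move=> yQ; elim: d yQ => [|d IH] yQ; first by rewrite !big_nil scale1r mulr1.
rewrite !big_nat_recr //=.
have Hd e : (e <= d)%N ->
    y d ^+ a d * (\prod_(0 <= i < e) y i ^+ b i) =
    (\prod_(0 <= j < e) Q d j ^+ (a d * b j)) *:
      ((\prod_(0 <= i < e) y i ^+ b i) * y d ^+ a d).
  elim: e => [|e IHe] ed; first by rewrite !big_nil mulr1 mul1r scale1r.
  rewrite !big_nat_recr //= mulrA (IHe (ltnW ed)) -scalerAl.
  rewrite -[_ * y d ^+ a d * _]mulrA (skew_commX _ _ (yQ d e _)) ?ed ?ltnSn //.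
  by rewrite -scalerAr scalerA mulrA.
rewrite -mulrA [y d ^+ a d * _]mulrA (Hd d) // -scalerAl -scalerAr mulrA mulrA.
rewrite IH => [|i j /andP[ji id]]; last by rewrite yQ // ji ltnW.
by rewrite -!scalerAl scalerA mulrC -mulrA -exprD.
Qed.

Lemma sktwist_nat (k : fieldType) (n : nat) (q : 'M[k]_n) (Q : nat -> nat -> k)
    (a b : nat -> nat) (m1 m2 : 'X_{1..n}) :
  (forall i j : 'I_n, Q i j = q i j) -> (forall i : 'I_n, a i = m1 i) ->
  (forall i : 'I_n, b i = m2 i) ->
  \prod_(0 <= i < n) \prod_(0 <= j < i) Q i j ^+ (a i * b j) = sktwist q m1 m2.
Proof.
move=> QE aE bE; rewrite big_mkord; apply: eq_bigr => i _.
rewrite big_mkord (big_ord_widen n (fun j => Q i j ^+ (a i * b j))) 1?ltnW //.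
by apply: eq_bigr => j _; rewrite QE aE bE.
Qed.

Section Universal.
Variables (k : fieldType) (n : nat) (q : 'M[k]_n) (E : algType k) (y : 'I_n -> E).
Hypothesis yq : forall i j, y i * y j = q i j *: (y j * y i).

Definition monval (m : 'X_{1..n}) : E := \prod_(i < n) y i ^+ m i.

Lemma monvalM m1 m2 : monval m1 * monval m2 = sktwist q m1 m2 *: monval (m1 + m2)%MM.
Proof.
(* Neutral values extend the families to all natural numbers, so that the formula for products over
   intervals, proved by induction on the number of variables, applies. *)
pose y' j := if insub j is Some i then y i else 1.
pose e (m : 'X_{1..n}) j := if insub j is Some i then m i else 0%N.
pose Q j l := if insub j is Some i then if insub l is Some i' then q i i' else 1 else 1.
have yE (i : 'I_n) : y' i = y i by rewrite /y' valK.
have eE m (i : 'I_n) : e m i = m i by rewrite /e valK.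
have QE (i j : 'I_n) : Q i j = q i j by rewrite /Q !valK.
have vE m : monval m = \prod_(0 <= i < n) y' i ^+ e m i.
  by rewrite big_mkord; apply: eq_bigr => i _; rewrite yE eE.
rewrite (vE m1) (vE m2) (skew_prodM _ _ (Q := Q)) => [|i j /andP[ji id]]; last first.
  have jd := ltn_trans ji id.
  by rewrite (yE (Ordinal id)) (yE (Ordinal jd)) yq (QE (Ordinal id) (Ordinal jd)).
congr (_ *: _).
  exact: sktwist_nat.
by rewrite big_mkord; apply: eq_bigr => i _; rewrite yE !eE mnmDE.
Qed.

Definition skeval (f : skpoly q) : E := \sum_(m <- sksupp f) skcoef m f *: monval m.

Lemma skevalw (d : {fset 'X_{1..n}}) (f : skpoly q) : (sksupp f `<=` d)%fset ->
  skeval f = \sum_(m <- d) skcoef m f *: monval m.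
Proof.
move=> le; apply: (big_fset_incl _ le) => m _ mf.
by rewrite sksuppPn // scale0r.
Qed.

Fact skeval_is_linear : linear skeval.
Proof.
move=> c f g; pose d := (sksupp f `|` sksupp g `|` sksupp (c *: f + g)%R)%fset.
rewrite !(skevalw (d := d)) ?fsubsetUr //.
- rewrite scaler_sumr -big_split; apply: eq_bigr => m _.
  by rewrite skcoefD skcoefZ scalerDl scalerA.
- by rewrite /d fsetUAC fsubsetUr.
- by rewrite /d -fsetUA fsubsetUl.
Qed.
HB.instance Definition _ := GRing.isLinear.Build k (skpoly q) E *:%R skeval
  skeval_is_linear.

Lemma skevalU c m : skeval (skterm q c m) = c *: monval m.
Proof.
by rewrite (skevalw (sksuppU _ _ _)) big_seq_fset1 skcoefU eqxx.
Qed.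

Fact skeval_is_monoid_morphism : monoid_morphism skeval.
Proof.
split=> [|f g].
  rewrite [X in skeval X]/1 /= /skone skevalU scale1r.
  by apply: big1 => i _; rewrite mnm0E.
rewrite (skE f) (skE g) mulr_suml !linear_sum mulr_suml; apply: eq_bigr => m1 _.
rewrite mulr_sumr linear_sum mulr_sumr; apply: eq_bigr => m2 _.
by rewrite /= sktermM !skevalU -scalerAl -scalerAr monvalM !scalerA.
Qed.

Fact skhom_subproof : {f : {rmorphism skpoly q -> E} |
  forall c m, f (skterm q c m) = c *: monval m}.
Proof.
pose m := GRing.isMonoidMorphism.Build (skpoly q) E skeval skeval_is_monoid_morphism.
pose F : {rmorphism skpoly q -> E} := HB.pack skeval m.
by exists F => c m'; exact: skevalU.
Qed.

Definition skhom := sval skhom_subproof.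

Lemma skhomU c m : skhom (skterm q c m) = c *: monval m.
Proof. exact: (svalP skhom_subproof). Qed.

Lemma skhomX i : skhom (skX q i) = y i.
Proof.
rewrite skhomU scale1r /monval.
rewrite (eq_bigr (fun j => if j == i then y j else 1)) => [|j _].
  by rewrite -big_mkcond big_pred1_eq.
by rewrite mnm1E eq_sym; case: eqP => [->|].
Qed.
End Universal.

Lemma skpoly_hom_ext (k : fieldType) (n : nat) (q : 'M[k]_n) (E : pzRingType)
    (f g : {rmorphism skpoly q -> E}) :
  (forall c, f c%:A = g c%:A) -> (forall i, f (skX q i) = g (skX q i)) -> f =1 g.
Proof.
move=> fgC fgX p; rewrite (skE p) !rmorph_sum; apply: eq_bigr => m _.
rewrite -[skcoef m p]mulr1 -sktermZ -skmonE -mulr_algl !rmorphM fgC; congr (_ * _).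
rewrite !rmorph_prod; apply: eq_bigr => i _.
by rewrite !rmorphXn fgX.
Qed.

Lemma lem0 n (m : 'X_{1..n}) : (m <= 0)%MM = (m == 0%MM).
Proof.
apply/mnm_lepP/eqP => [m0|-> //]; apply/mnmP => i.
by apply/eqP; rewrite mnm0E -leqn0 -[X in (_ <= X)%N](mnm0E i).
Qed.

Lemma skhomC (k : fieldType) (n : nat) (q : 'M[k]_n) (E : algType k) (y : 'I_n -> E)
  (yq : forall i j, y i * y j = q i j *: (y j * y i)) c : skhom yq c%:A = c%:A.
Proof.
rewrite [X in c *: X]/1 /= /skone sktermZ mulr1 skhomU; congr (_ *: _).
by apply: big1 => i _; rewrite mnm0E.
Qed.

(** * Commutation of terms, and low coefficients of products *)

Section Commutation.
Variables (k : fieldType) (n : nat) (q : 'M[k]_n).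
Hypothesis qS : is_skew_mx q.
Implicit Types m : 'X_{1..n}.

Lemma sktwist_neq0 m1 m2 : sktwist q m1 m2 != 0.
Proof.
case: qS => q0 _ _; rewrite prodf_seq_neq0; apply/allP => i _.
rewrite /= prodf_seq_neq0; apply/allP => j _; apply/implyP => _.
by rewrite expf_neq0.
Qed.

(** In the product over all pairs (i, j) the part j < i is the twist of (m1, m2), the diagonal is 1,
    and the part i < j is inverse to the twist of (m2, m1). *)
Lemma sktwistC m1 m2 : sktwist q m1 m2 =
  (\prod_i \prod_j q i j ^+ (m1 i * m2 j)) * sktwist q m2 m1.
Proof.
case: (qS) => q0 q1 qV.
have -> : \prod_i \prod_j q i j ^+ (m1 i * m2 j) =
    sktwist q m1 m2 * \prod_(i < n) \prod_(j < n | (i < j)%N) q i j ^+ (m1 i * m2 j).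
  rewrite /sktwist -big_split; apply: eq_bigr => i _ /=.
  rewrite (bigID (fun j : 'I_n => (j < i)%N)) /=; congr (_ * _).
  rewrite (bigD1 i) ?ltnn //= q1 expr1n mul1r; apply: eq_bigl => j.
  by rewrite -leqNgt ltn_neqAle andbC eq_sym.
rewrite -mulrA -[LHS]mulr1; congr (_ * _).
rewrite (exchange_big_dep xpredT) //= /sktwist -big_split big1 // => i _ /=.
rewrite -big_split big1 // => j ji /=.
by rewrite [q i j]qV exprVn mulnC mulfV // expf_neq0.
Qed.

Lemma sktermC c1 c2 m1 m2 : skterm q c1 m1 * skterm q c2 m2 =
  (\prod_i \prod_j q i j ^+ (m1 i * m2 j)) *: (skterm q c2 m2 * skterm q c1 m1).
Proof.
rewrite !sktermM sktermZ addmC sktwistC; congr skterm.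
by rewrite [c2 * c1]mulrC [RHS]mulrCA.
Qed.

(** Scalars are tracked only up to being nonzero, because monomial ideals depend on supports
    alone. *)
Lemma skterm_exp c m d : exists c', skterm q c m ^+ d = skterm q c' (m *+ d)%MM /\
  (c != 0 -> c' != 0).
Proof.
elim: d => [|d [c' [IH c'0]]].
  by exists 1; rewrite expr0 mulm0n; split=> // _; exact: oner_neq0.
exists (c * c' * sktwist q m (m *+ d)%MM); rewrite exprS IH sktermM mulmS.
by split=> // c0; rewrite !mulf_neq0 ?sktwist_neq0 ?c'0.
Qed.

Lemma skterm_prod (I : Type) (r : seq I) (c : I -> k) (m : I -> 'X_{1..n}) :
  exists c', \prod_(i <- r) skterm q (c i) (m i) = skterm q c' (\sum_(i <- r) m i)%MM
    /\ ((forall i, c i != 0) -> c' != 0).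
Proof.
elim: r => [|i r [c' [IH c'0]]].
  by exists 1; rewrite !big_nil; split=> // _; exact: oner_neq0.
exists (c i * c' * sktwist q (m i) (\sum_(i <- r) m i)%MM).
rewrite !big_cons IH sktermM; split=> // c0.
by rewrite !mulf_neq0 ?sktwist_neq0 ?c'0.
Qed.

Lemma skhom_term (p : nat) (r : 'M[k]_p) (co : 'I_p -> k) (ex : 'I_p -> 'X_{1..n})
    (yq : forall i j, skterm q (co i) (ex i) * skterm q (co j) (ex j) =
      r i j *: (skterm q (co j) (ex j) * skterm q (co i) (ex i))) c (m : 'X_{1..p}) :
  exists c', skhom yq (skterm r c m) = skterm q c' (\sum_i ex i *+ m i)%MM /\
    ((forall i, co i != 0) -> c != 0 -> c' != 0).
Proof.
rewrite skhomU /monval; have /boolp.choice[d dP] i := skterm_exp (co i) (ex i) (m i).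
have [d' [d'E d'0]] := skterm_prod (index_enum 'I_p) d (fun i => ex i *+ m i)%MM.
exists (c * d'); rewrite -sktermZ -d'E; split=> [|co0 c0].
  by congr (_ *: _); apply: eq_bigr => i _; case: (dP i).
by rewrite mulf_neq0 // d'0 // => i; case: (dP i) => _; apply.
Qed.

Lemma skcoefMr c m m0 (f : skpoly q) :
  skcoef (m + m0)%MM (f * skterm q c m0) = skcoef m f * c * sktwist q m m0.
Proof.
rewrite {1}(skE f) mulr_suml skcoef_sum.
under eq_bigr do rewrite sktermM skcoefU eqm_add2r.
have [mf|mf] := boolP (m \in sksupp f); last first.
  rewrite (sksuppPn mf) !mul0r big1_fset // => m' m'f _.
  by case: eqP mf => // <-; rewrite m'f.
rewrite (big_fsetD1 m) //= eqxx big1_fset ?addr0 // => m' /fsetD1P[ne _] _.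
by rewrite (negPf ne).
Qed.

Lemma skcoefMr0 c m m0 (f : skpoly q) : ~~ (m0 <= m)%MM ->
  skcoef m (f * skterm q c m0) = 0.
Proof.
move=> mm0; rewrite {1}(skE f) mulr_suml skcoef_sum.
apply: big1 => m' _; rewrite sktermM skcoefU; case: eqP => // e.
by move: mm0; rewrite -e lem_addl.
Qed.

Lemma skcoefM0 (f g : skpoly q) : skcoef 0%MM (f * g) = skcoef 0%MM f * skcoef 0%MM g.
Proof.
rewrite {1}(skE g) mulr_sumr skcoef_sum.
have [mf|mf] := boolP (0%MM \in sksupp g); last first.
  rewrite (sksuppPn mf) mulr0 big1_fset // => m mg _; apply: skcoefMr0.
  by rewrite lem0; case: eqP mf => // <-; rewrite mg.
rewrite (big_fsetD1 0%MM) //= big1_fset ?addr0 => [|m /fsetD1P[ne _] _]; last first.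
  by apply: skcoefMr0; rewrite lem0.
by rewrite -{1}[0%MM]addm0 skcoefMr sktwistm0 mulr1.
Qed.

(** Linear coefficients are derivations relative to the constant term, so they vanish on products of
    two elements without constant term. *)
Lemma skcoefM1 (i : 'I_n) (f g : skpoly q) :
  skcoef U_(i)%MM (f * g) =
  skcoef U_(i)%MM f * skcoef 0%MM g + skcoef 0%MM f * skcoef U_(i)%MM g.
Proof.
rewrite (skE g) mulr_sumr !skcoef_sum !mulr_sumr -big_split; apply: eq_bigr => m _ /=.
rewrite !skcoefU; have [->|m0] := eqVneq m 0%MM.
  rewrite -{1}[U_(i)%MM]addm0 skcoefMr sktwistm0 mulr1 mulr1n.
  have -> : (0%MM == U_(i)%MM :> 'X_{1..n}) = false by rewrite eq_sym mnm1_eq0.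
  by rewrite mulr0n mulr0 addr0.
rewrite mulr0n mulr0 add0r; have [->|mi] := eqVneq m U_(i)%MM.
  by rewrite -{1}[U_(i)%MM]add0m skcoefMr sktwist0m mulr1 mulr1n.
rewrite mulr0n mulr0 skcoefMr0 //; apply: contra mi => /mnm_lepP mi.
have [mi0|mi_gt0] := posnP (m i).
  case/eqP: m0; apply/mnmP => l; rewrite mnm0E; have := mi l.
  by rewrite mnm1E; case: eqP => [<-|_]; rewrite ?mi0 // leqn0 => /eqP.
apply/eqP/mnmP => l; have := mi l; rewrite mnm1E.
case: eqP => [<-|_]; last by rewrite leqn0 => /eqP.
by rewrite leq_eqVlt ltnS leqn0 eqn0Ngt mi_gt0 orbF => /eqP.
Qed.
End Commutation.

(** * Quotients by monomial ideals *)

Section IdquotMorphisms.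
Variables (A : pzRingType) (X : A -> Prop).

Lemma idproj_eq0 a : idproj X a = 0 <-> a \in ideal_gen X.
Proof. by rewrite -(raddf0 (idproj X)) eq_idproj subr0. Qed.

Lemma idquot_additive (V : zmodType) (g : {additive A -> V}) :
  (forall r, r \in ideal_gen X -> g r = 0) ->
  exists h : {additive idquot X -> V}, forall a, h (idproj X a) = g a.
Proof.
move=> gX; have [r rP] := boolp.choice (@idprojP _ X).
have gr a : g (r (idproj X a)) = g a.
  by apply/eqP; rewrite -subr_eq0 -raddfB; apply/eqP/gX/eq_idproj; rewrite -rP.
have [h hE] : exists h : {additive idquot X -> V}, h =1 g \o r.
  apply: additive_of => x y /=.
  by rewrite {1}(rP x) {1}(rP y) -raddfB gr raddfB.
by exists h => a; rewrite hE /= gr.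
Qed.

Lemma idquot_rmorphism (C : pzRingType) (g : {rmorphism A -> C}) :
  (forall x, X x -> g x = 0) ->
  exists h : {rmorphism idquot X -> C}, forall a, h (idproj X a) = g a.
Proof.
move=> gX; have [|h hE] := @idquot_additive C g.
  move=> r /ideal_genP[l lX ->]; rewrite raddf_sum big1_seq // => t /andP[_ tl].
  suff E : g (t.1.1 * t.1.2 * t.2) = 0 by exact: E.
  by rewrite !rmorphM (gX _ (lX _ tl)) mulr0 mul0r.
have {}hE b : h (idproj X b) = g b by exact: hE.
have hM : monoid_morphism h.
  split=> [|x y]; first by rewrite -(rmorph1 (idproj X)) hE rmorph1.
  have [[a ->] [b ->]] := (idprojP x, idprojP y).
  by rewrite -rmorphM !hE rmorphM.
pose m := GRing.isMonoidMorphism.Build _ _ h hM.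
by pose F : {rmorphism idquot X -> C} := HB.pack (h : _ -> _) m h; exists F.
Qed.

Lemma idquot_linear : exists e : {linear (A^c)^o -> idquot X},
  (forall x, exists b, e b = x) /\ (forall b : A, e b = 0 <-> b \in ideal_gen X).
Proof.
have /linear_of[e eE] : linear (idproj X : (A^c)^o -> idquot X).
  by move=> c x y; rewrite raddfD; congr (_ + _); exact: rmorphM.
exists e; split=> [x|b]; last by rewrite eE idproj_eq0.
by have [b ->] := idprojP x; exists b; rewrite eE.
Qed.
End IdquotMorphisms.

Section MonomialIdeal.
Variables (k : fieldType) (n : nat) (q : 'M[k]_n) (s : nat) (a : 'I_s -> 'X_{1..n}).
Hypothesis qS : is_skew_mx q.

Definition moneq : skpoly q -> Prop := fun r => exists i, r = skmon q (a i).

Definition monmult (m : 'X_{1..n}) : Prop := exists i, (a i <= m)%MM.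

Lemma skcoefMl0 m m0 (f g : skpoly q) :
  (forall m', ~~ (m0 <= m')%MM -> skcoef m' f = 0) -> ~~ (m0 <= m)%MM ->
  skcoef m (f * g) = 0.
Proof.
move=> f0 mm0; rewrite (skE f) (skE g) mulr_suml skcoef_sum big1_seq // => m1 /=.
move=> m1f; rewrite mulr_sumr skcoef_sum big1 // => m2 _.
rewrite sktermM skcoefU; case: eqP => // e; case/negP: mm0; rewrite -e.
apply: lepm_trans (lem_addr _ _); apply: contraLR m1f => /f0 m1f.
by rewrite sksuppE m1f eqxx.
Qed.

Lemma skterm_ideal c m : monmult m -> skterm q c m \in ideal_gen moneq.
Proof.
move=> [i im]; have t0 := sktwist_neq0 qS (m - a i)%MM (a i).
have -> : skterm q c m = skterm q (c / sktwist q (m - a i)%MM (a i)) (m - a i)%MM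
                         * skmon q (a i) * 1.
  by rewrite mulr1 skmonE sktermM mulr1 divfK // submK.
rewrite -mulrA; apply/ideal_genMl/ideal_genP.
exists [:: (1, skmon q (a i), 1)]; last by rewrite big_seq1 mul1r.
by move=> t; rewrite inE => /eqP ->; exists i.
Qed.

(** Since monomials multiply to nonzero multiples of monomials, membership in the two-sided ideal
    can be read off the support; later arguments about the ideal are about divisibility of
    exponents. *)
Lemma monidealP (f : skpoly q) :
  f \in ideal_gen moneq <-> forall m, skcoef m f != 0 -> monmult m.
Proof.
split=> [/ideal_genP[l lX ->] m|fX]; last first.
  rewrite (skE f) big_seq; apply: rpred_sum => m; rewrite sksuppE => /fX.
  exact: skterm_ideal.
case: (boolp.EM (monmult m)) => // nm; rewrite skcoef_sum big1_seq ?eqxx // => t.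
move=> /andP[_ /lX[i ->]]; have mi : ~~ (a i <= m)%MM.
  by apply/negP => mi; apply: nm; exists i.
by apply: skcoefMl0 mi => m'; rewrite skmonE => m'i; rewrite skcoefMr0.
Qed.
End MonomialIdeal.

(** * The residue field and its Betti numbers *)

Section Augmentation.
Variables (k : fieldType) (n : nat) (q : 'M[k]_n) (s : nat) (a : 'I_s -> 'X_{1..n}).
Hypothesis qS : is_skew_mx q.

Local Notation proj := (idproj (moneq (q := q) a)).
Local Notation S := (monquot q a).

Definition mqsc : {rmorphism k -> S} := proj \o in_alg (skpoly q).

Definition is_mqeps (eps : {rmorphism S -> k}) : Prop :=
  forall f : skpoly q, eps (proj f) = skcoef 0%MM f.

Lemma skcoef_is_additive m : {morph @skcoef k n q m : f g / f - g}.
Proof. by move=> f g; rewrite skcoefD -scaleN1r skcoefZ mulN1r. Qed.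

Lemma skcoef0_rmorphism : exists h : {rmorphism skpoly q -> k},
  forall f, h f = skcoef 0%MM f.
Proof.
pose ma := GRing.isZmodMorphism.Build _ _ (@skcoef k n q 0%MM) (skcoef_is_additive 0%MM).
have mm : monoid_morphism (@skcoef k n q 0%MM).
  split=> [|f g]; last exact: skcoefM0.
  by rewrite [X in skcoef _ X]/1 /= /skone skcoefU eqxx.
pose mb := GRing.isMonoidMorphism.Build _ _ (@skcoef k n q 0%MM) mm.
by pose F : {rmorphism skpoly q -> k} := HB.pack (@skcoef k n q 0%MM) ma mb; exists F.
Qed.

Lemma mqeps_exists : (forall i, 0 < mdeg (a i))%N ->
  exists eps : {rmorphism S -> k}, is_mqeps eps.
Proof.
move=> a0; have [h hE] := skcoef0_rmorphism.
have [|eps epsE] := @idquot_rmorphism _ (moneq (q := q) a) _ h.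
  move=> _ [i ->]; rewrite hE skmonE skcoefU; case: eqP => // e.
  by move: (a0 i); rewrite e mdeg0.
by exists eps => f; rewrite epsE hE.
Qed.

Lemma mqscK (eps : {rmorphism S -> k}) : is_mqeps eps -> forall c, eps (mqsc c) = c.
Proof.
move=> epsE c; rewrite epsE /= skcoefZ [X in skcoef _ X]/1 /= /skone.
by rewrite skcoefU eqxx mulr1.
Qed.

Lemma monquot_irrP (eps : {rmorphism S -> k}) : is_mqeps eps ->
  forall x : S, x \in monquot_irr (q := q) (a := a) <-> eps x = 0.
Proof.
move=> epsE x; split=> [/ideal_genP[l lX ->]|].
  rewrite rmorph_sum big1_seq // => t /andP[_ /lX[i ->]].
  by rewrite !rmorphM /= epsE skcoefU mnm1_eq0 mulr0n mulr0 mul0r.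
have [f ->] := idprojP x; rewrite epsE => f0.
rewrite (skE f) rmorph_sum; apply: rpred_sum => m _.
have [m0|m0] := eqVneq m 0%MM.
  by rewrite m0 f0 skterm0 rmorph0 rpred0.
have [i mi] : exists i, (0 < m i)%N.
  apply/existsP; apply: contraNT m0; rewrite negb_exists => /forallP m0.
  by apply/eqP/mnmP => i; rewrite mnm0E; apply/eqP; rewrite -leqn0 leqNgt m0.
have im : (U_(i) <= m)%MM by apply/mnm_lepP => j; rewrite mnm1E; case: eqP => // <-.
have t0 := sktwist_neq0 qS (m - U_(i))%MM U_(i)%MM.
have -> : skterm q (skcoef m f) m =
    skterm q (skcoef m f / sktwist q (m - U_(i))%MM U_(i)%MM) (m - U_(i))%MM * skX q i.
  by rewrite sktermM mulr1 divfK // submK.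
rewrite rmorphM; apply/ideal_genMl/ideal_genP.
exists [:: (1, proj (skX q i), 1)]; last by rewrite big_seq1 mul1r mulr1.
by move=> t; rewrite inE => /eqP ->; exists i.
Qed.

Lemma resfield_proj (eps : {rmorphism S -> k}) : is_mqeps eps ->
  exists e : {linear (S^c)^o -> resfield q a},
    (forall x, exists b, e b = x) /\ (forall b : S, e b = 0 <-> eps b = 0).
Proof.
move=> epsE; have [e [eS eE]] := idquot_linear (monquot_var (q := q) (a := a)).
by exists e; split=> // b; rewrite eE -(monquot_irrP epsE).
Qed.

(** Tor dimensions take the place of ranks in a resolution: they depend on the ring alone and can be
    carried from a quotient to the ring above it. *)
Definition betti (P : nat -> nat) : Prop :=
  exists2 eps : {rmorphism S -> k}, is_mqeps eps &
    forall i, tor eps mqsc i (resfield q a) (P i).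

Lemma betti_uniq (P Q : nat -> nat) : betti P -> betti Q -> P =1 Q.
Proof.
move=> [eps epsE HP] [eps' epsE' HQ] i; apply: tor_uniq (HP i) _.
apply: tor_eps_ext (HQ i) => x; have [f ->] := idprojP x.
by rewrite epsE epsE'.
Qed.

Lemma betti_resolution (P : nat -> nat) : (forall i, 0 < mdeg (a i))%N ->
  is_poincare_resfield q a P -> betti P.
Proof.
move=> /mqeps_exists[eps epsE] [F PF]; exists eps => // i; rewrite PF.
apply: tor_min_graded_resolution; first exact: mqscK.
by move=> x; rewrite (monquot_irrP epsE).
Qed.
End Augmentation.

(** * Substituting a monomial for a variable *)

Section Lift.
Variables (n : nat) (h : 'I_n.+1).
Implicit Types (m : 'X_{1..n.+1}) (p : 'X_{1..n}).

Definition mrest m : 'X_{1..n} := [multinom m (lift h i) | i < n].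
Definition minc p : 'X_{1..n.+1} :=
  [multinom (if unlift h i is Some j then p j else 0%N) | i < n.+1].

Lemma mrestE m i : mrest m i = m (lift h i). Proof. exact: mnmE. Qed.
Lemma mincE p i : minc p (lift h i) = p i. Proof. by rewrite mnmE liftK. Qed.
Lemma minch p : minc p h = 0%N. Proof. by rewrite mnmE unlift_none. Qed.

Lemma mnm_liftP m1 m2 :
  m1 h = m2 h -> (forall i, m1 (lift h i) = m2 (lift h i)) -> m1 = m2.
Proof. by move=> eh el; apply/mnmP => i; case: (unliftP h i) => [j|] ->. Qed.

Lemma lem_liftP m1 m2 :
  (m1 h <= m2 h)%N -> (forall i, m1 (lift h i) <= m2 (lift h i))%N -> (m1 <= m2)%MM.
Proof. by move=> eh el; apply/mnm_lepP => i; case: (unliftP h i) => [j|] ->. Qed.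

Lemma mincD p1 p2 : minc (p1 + p2)%MM = (minc p1 + minc p2)%MM.
Proof. by apply: mnm_liftP => [|i]; rewrite !(mnmDE, minch, mincE). Qed.

Lemma mrestK m : m h = 0%N -> minc (mrest m) = m.
Proof. by move=> mh; apply: mnm_liftP => [|i]; rewrite ?minch ?mincE ?mrestE. Qed.
End Lift.

Section Substitution.
Variables (k : fieldType) (n s : nat) (q : 'M[k]_n.+1) (q' : 'M[k]_n).
Variables (a : 'I_s -> 'X_{1..n.+1}) (a' : 'I_s -> 'X_{1..n}).
Variables (h : 'I_n.+1) (ep : bool) (mu : 'X_{1..n}).
Hypotheses (qS : is_skew_mx q) (qE : forall i j, q' i j = q (lift h i) (lift h j)).
Hypotheses (muq : ep -> forall j, q h (lift h j) = \prod_i q' i j ^+ mu i)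
  (mu0 : ep -> mu != 0%MM).
Hypotheses (aE : forall t, a' t = (mrest h (a t) + mu *+ a t h)%MM)
  (ah : forall t, (a t h <= ep)%N)
  (achain : ep -> forall t u, a t h = 1%N -> a u h = 0%N ->
     forall i, (0 < mu i)%N -> (a u (lift h i) <= a t (lift h i))%N).
Hypothesis adeg : forall t, (1 < mdeg (a t))%N.

Lemma subst_skew : is_skew_mx q'.
Proof. by case: qS => q0 q1 qV; split=> *; rewrite !qE. Qed.

(* The images of the variables: the [h]-th one is replaced by the monomial [mu] if
   [ep] holds, and by 0 otherwise. *)
Let co (i : 'I_n.+1) : k := if unlift h i is Some j then 1 else ep%:R.
Let ex (i : 'I_n.+1) : 'X_{1..n} := if unlift h i is Some j then U_(j)%MM else mu.
Let coh : co h = ep%:R. Proof. by rewrite /co unlift_none. Qed.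
Let col j : co (lift h j) = 1. Proof. by rewrite /co liftK. Qed.
Let exh : ex h = mu. Proof. by rewrite /ex unlift_none. Qed.
Let exl j : ex (lift h j) = U_(j)%MM. Proof. by rewrite /ex liftK. Qed.

Lemma subst_comm i j : skterm q' (co i) (ex i) * skterm q' (co j) (ex j) =
  q i j *: (skterm q' (co j) (ex j) * skterm q' (co i) (ex i)).
Proof.
have [q0 q1 qV] := qS.
have H l : skterm q' ep%:R mu * skX q' l = q h (lift h l) *: (skX q' l * skterm q' ep%:R mu).
  case: ep muq => [/(_ isT) qh|_]; last by rewrite skterm0 mul0r mulr0 scaler0.
  rewrite [LHS](sktermC subst_skew) qh; congr (_ *: _); apply: eq_bigr => i' _.
  rewrite (bigD1 l) //= mnm1E eqxx muln1 big1 ?mulr1 // => j' /negPf j'l.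
  by rewrite mnm1E eq_sym j'l muln0.
case: (unliftP h i) => [i' ->|->]; case: (unliftP h j) => [j' ->|->];
  rewrite ?coh ?col ?exh ?exl.
- by rewrite -qE; exact: (skX_comm subst_skew).
- by rewrite [q _ h]qV [X in _ *: X]H scalerA mulVf ?scale1r.
- exact: H.
- by rewrite q1 scale1r.
Qed.

Definition sksubst : {rmorphism skpoly q -> skpoly q'} := skhom subst_comm.

Lemma sksubstC c : sksubst c%:A = c%:A. Proof. exact: skhomC. Qed.
Lemma sksubstX i : sksubst (skX q i) = skterm q' (co i) (ex i).
Proof. exact: skhomX. Qed.

Lemma sksubst_term c m :
  exists c', sksubst (skterm q c m) = skterm q' c' (mrest h m + mu *+ m h)%MM.
Proof.
have [c' [-> _]] := skhom_term subst_skew subst_comm c m; exists c'; congr skterm.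
rewrite (bigD1_ord h) //= exh addmC; congr (_ + _)%MM.
apply/mnmP => l; rewrite mnm_sumE mrestE (bigD1 l) //= exl mulmnE mnm1E eqxx mul1n.
by rewrite big1 ?addn0 // => j /negPf jl; rewrite exl mulmnE mnm1E jl mul0n.
Qed.

Lemma lift_comm i j : skterm q 1 U_(lift h i)%MM * skterm q 1 U_(lift h j)%MM =
  q' i j *: (skterm q 1 U_(lift h j)%MM * skterm q 1 U_(lift h i)%MM).
Proof. by rewrite qE; exact: (skX_comm qS). Qed.

Definition skinc : {rmorphism skpoly q' -> skpoly q} := skhom lift_comm.

Lemma skincC c : skinc c%:A = c%:A. Proof. exact: skhomC. Qed.
Lemma skincX i : skinc (skX q' i) = skX q (lift h i). Proof. exact: skhomX. Qed.

Lemma skinc_term c m : exists2 c', skinc (skterm q' c m) = skterm q c' (minc h m) &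
  c != 0 -> c' != 0.
Proof.
have [c' [E c'0]] := skhom_term qS lift_comm c m; exists c'; last first.
  by apply: c'0 => _; exact: oner_neq0.
rewrite [LHS]E; congr skterm; apply: (mnm_liftP (h := h)) => [|l].
  rewrite minch mnm_sumE big1 // => i _; rewrite mulmnE mnm1E.
  by rewrite eq_sym (negPf (neq_lift _ _)).
rewrite mincE mnm_sumE (bigD1 l) //= mulmnE mnm1E eqxx mul1n.
rewrite big1 ?addn0 // => j /negPf jl.
by rewrite mulmnE mnm1E (inj_eq lift_inj) jl mul0n.
Qed.

Lemma skincK f : sksubst (skinc f) = f.
Proof.
have H := @skpoly_hom_ext k n q' (skpoly q') (sksubst \o skinc) idfun.
apply: H => [c|i] /=; first by rewrite skincC sksubstC.
by rewrite skincX sksubstX col exl.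
Qed.

Definition skdiff : skpoly q := skX q h - skinc (skterm q' ep%:R mu).

Lemma sksubst_diff : sksubst skdiff = 0.
Proof. by rewrite rmorphB skincK sksubstX coh exh subrr. Qed.

Lemma skdiffE : exists2 g, skdiff = skX q h - skterm q g (minc h mu) & (g != 0) = ep.
Proof.
rewrite /skdiff; case: (ep).
  by have [g -> g0] := skinc_term 1 mu; exists g => //; apply: g0; exact: oner_neq0.
by exists 0; rewrite ?eqxx // !skterm0 rmorph0.
Qed.

Lemma sksubst_coef0 f : skcoef 0%MM (sksubst f) = skcoef 0%MM f.
Proof.
have [e eE] := skcoef0_rmorphism q; have [e' eE'] := skcoef0_rmorphism q'.
rewrite -eE -eE'; have H := @skpoly_hom_ext k _ q k (e' \o sksubst) e.
apply: H => [c|i] /=.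
  rewrite sksubstC eE eE' !skcoefZ [X in _ * skcoef _ X = _]/1 [X in _ = _ * skcoef _ X]/1.
  by rewrite /= /skone !skcoefU !eqxx.
rewrite sksubstX eE eE' !skcoefU mnm1_eq0 mulr0n.
case: (unliftP h i) => [j|] ->; first by rewrite exl mnm1_eq0.
by rewrite coh exh; case: (ep) mu0 => [/(_ isT)/negPf->|_]; rewrite ?mul0rn.
Qed.

(** Replacing a factor x_h by [mu], which is free of x_h, lowers the exponent of x_h, so division
    with remainder terminates. Together with [skincK] this identifies the kernel of [sksubst] with
    the left multiples of [skdiff]. *)
Lemma skdiff_decomp f : exists g x, f = skinc g + x * skdiff.
Proof.
rewrite (skE f); elim: (sksupp f : seq _) => [|m l [g [x IH]]].
  by exists 0, 0; rewrite big_nil rmorph0 mul0r addr0.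
rewrite big_cons IH; suff [g' [x' ->]] : exists g' x',
    skterm q (skcoef m f) m = skinc g' + x' * skdiff.
  by exists (g' + g), (x' + x); rewrite rmorphD mulrDl addrACA.
move: (skcoef m f) => c; have [d] := ubnP (m h); elim: d m c {IH} => // d IH m c.
rewrite ltnS => md; have [m0|mh] := posnP (m h).
  have [c' E c'0] := skinc_term 1 (mrest h m).
  exists (skterm q' (c / c') (mrest h m)), 0; rewrite mul0r addr0.
  have -> : skterm q' (c / c') (mrest h m) = (c / c')%:A * skterm q' 1 (mrest h m).
    by rewrite mulr_algl sktermZ mulr1.
  rewrite rmorphM skincC E mrestK // mulr_algl sktermZ.
  by rewrite divfK // c'0 // oner_neq0.
have hm : (U_(h) <= m)%MM by apply/mnm_lepP => j; rewrite mnm1E; case: eqP => // <-.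
pose m1 := (m - U_(h))%MM; have t0 := sktwist_neq0 qS m1 U_(h)%MM.
have [g0 dE _] := skdiffE.
pose x0 := skterm q (c / sktwist q m1 U_(h)%MM) m1.
have E : skterm q c m = x0 * skdiff + x0 * skterm q g0 (minc h mu).
  rewrite dE mulrBr subrK /x0 sktermM mulr1 divfK //.
  by rewrite /m1 submK.
rewrite E {2}/x0 sktermM.
have [|g' [x' ->]] := IH (m1 + minc h mu)%MM
  (c / sktwist q m1 U_(h)%MM * g0 * sktwist q m1 (minc h mu)).
  rewrite mnmDE minch addn0 /m1 mnmBE mnm1E eqxx subn1.
  by rewrite prednK.
by exists g', (x0 + x'); rewrite mulrDl addrCA.
Qed.

(** The generator a'_t arises from a_t by putting [mu] for x_h; modulo left multiples of [skdiff], a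
    factor [mu] in a multiple of a'_t can be turned back into x_h. *)
Lemma skinc_ideal g : g \in ideal_gen (moneq (q := q') a') ->
  exists x, skinc g - x * skdiff \in ideal_gen (moneq (q := q) a).
Proof.
move/(monidealP a' subst_skew) => gI; rewrite (skE g) big_seq.
pose T f := exists x, skinc f - x * skdiff \in ideal_gen (moneq (q := q) a).
apply: (big_ind T).
- by exists 0; rewrite rmorph0 mul0r subr0 rpred0.
- move=> f1 f2 [x1 H1] [x2 H2]; exists (x1 + x2).
  by rewrite rmorphD mulrDl opprD addrACA rpredD.
move=> m; rewrite sksuppE /T => /gI[t]; rewrite aE; set c := skcoef m g => tm.
have [c' -> _] := skinc_term c m; have [g0 dE g0ep] := skdiffE.
have /mnm_lepP tm' := tm.
have [ath|ath] := posnP (a t h).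
  exists 0; rewrite mul0r subr0; apply: (skterm_ideal qS); exists t.
  apply: (lem_liftP (h := h)) => [|i]; first by rewrite ath.
  by rewrite mincE; have := tm' i; rewrite mnmDE mrestE ath mulm0n mnm0E addn0.
have epT : ep by move: (leq_trans ath (ah t)); case: (ep).
have ath1 : a t h = 1%N.
  by apply/eqP; rewrite eqn_leq ath andbT; move: (ah t); rewrite epT.
rewrite ath1 mulm1n in tm tm'.
have mum : (mu <= m)%MM by apply: lepm_trans tm; exact: lem_addl.
pose y := (m - mu)%MM.
have yE : (minc h y + minc h mu)%MM = minc h m by rewrite -mincD /y submK.
have t0 := sktwist_neq0 qS (minc h y) (minc h mu).
have g0n : g0 != 0 by rewrite g0ep.
pose c1 := c' / g0 / sktwist q (minc h y) (minc h mu).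
have -> : skterm q c' (minc h m) = skterm q c1 (minc h y) * (skX q h - skdiff).
  by rewrite dE subKr sktermM yE /c1 mulrAC divfK // divfK.
exists (- skterm q c1 (minc h y)).
rewrite mulrBr mulNr opprK subrK sktermM; apply: (skterm_ideal qS); exists t.
apply: (lem_liftP (h := h)) => [|i]; first by rewrite ath1 mnmDE minch mnm1E eqxx.
rewrite mnmDE mincE /y mnmBE; have := tm' i; rewrite mnmDE mrestE => ti.
by apply: leq_trans (leq_addr _ _); rewrite leq_subRL ?(leq_trans _ ti) ?leq_addl // addnC.
Qed.

(** Suppose a monomial m of f lies outside the ideal. The coefficient at m x_h shows that m is free
    of x_h and that some a_t involving x_h divides m x_h; the coefficient at m mu gives some a_u
    free of x_h that divides m mu. At the variables of mu the chain condition bounds a_u by a_t,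
    hence by m; elsewhere a_u is bounded by m already. So a_u divides m, a contradiction. *)
Lemma skdiff_regular f : f * skdiff \in ideal_gen (moneq (q := q) a) ->
  f \in ideal_gen (moneq (q := q) a).
Proof.
move/(monidealP a qS) => fI; apply/(monidealP a qS) => m mf.
have [g dE gep] := skdiffE; rewrite dE in fI.
have coefB m0 : skcoef m0 (f * (skX q h - skterm q g (minc h mu))) =
    skcoef m0 (f * skX q h) - skcoef m0 (f * skterm q g (minc h mu)).
  by rewrite mulrBr skcoef_is_additive.
apply: boolp.contrapT => mI.
have claim m1 : skcoef m1 f != 0 -> ~ monmult a m1 ->
    m1 h = 0%N /\ exists2 t, (a t <= m1 + U_(h))%MM & a t h = 1%N.
  pose D := \max_(m <- sksupp f) m h.
  have DE m2 : skcoef m2 f != 0 -> (m2 h <= D)%N.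
    rewrite -sksuppE => m2f.
    exact: (@leq_bigmax_seq _ _ (fun=> true) (fun m : 'X_{1..n.+1} => m h)).
  (* If the coefficient at m1 x_h vanishes, it is cancelled through a monomial [m2] of f with a
     larger exponent at x_h. Exponents are bounded by [D], so the claim is available for [m2], and
     its conclusion that [m2] is free of x_h is absurd. *)
  have [d] := ubnP (D - m1 h); elim: d m1 => // d IH m1; rewrite ltnS => dm m1f m1I.
  have [t tm] : monmult a (m1 + U_(h))%MM.
    have [|nz] := eqVneq (skcoef (m1 + U_(h))%MM
      (f * (skX q h - skterm q g (minc h mu)))) 0; last exact: fI.
    rewrite coefB skcoefMr => /eqP; rewrite mulr1 subr_eq0 => /eqP e.
    have nz : skcoef (m1 + U_(h))%MM (f * skterm q g (minc h mu)) != 0.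
      by rewrite -e mulf_neq0 ?sktwist_neq0.
    have lm : (minc h mu <= m1 + U_(h))%MM by apply: contraNT nz => /skcoefMr0 ->.
    pose m2 := (m1 + U_(h) - minc h mu)%MM.
    have m2E : (m2 + minc h mu)%MM = (m1 + U_(h))%MM by rewrite submK.
    have m2f : skcoef m2 f != 0.
      by apply: contraNneq nz => m20; rewrite -m2E skcoefMr m20 !mul0r.
    have m2h : m2 h = (m1 h).+1 by rewrite mnmBE mnmDE minch mnm1E eqxx subn0 addn1.
    case: (boolp.EM (monmult a m2)) => [[u um2]|m2I].
      by exists u; rewrite -m2E; apply: lepm_trans um2 (lem_addr _ _).
    have [||//|m20 _] := IH m2; last by rewrite m2h in m20.
      apply: leq_trans dm; rewrite m2h ltn_sub2l //.
      by rewrite -m2h; exact: DE.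
    by [].
  have thm : (m1 h < a t h)%N.
    rewrite ltnNge; apply/negP => th; apply: m1I; exists t.
    apply: (lem_liftP (h := h)) => // i; have /mnm_lepP/(_ (lift h i)) := tm.
    by rewrite mnmDE mnm1E (negPf (neq_lift _ _)) addn0.
  have th1 : (a t h <= 1)%N by apply: leq_trans (ah t) _; case: (ep).
  have m10 : m1 h = 0%N by apply/eqP; rewrite -leqn0 -ltnS (leq_trans thm).
  by split=> //; exists t => //; apply/eqP; rewrite eqn_leq th1 (leq_trans _ thm).
have [m0 [t tm th]] := claim _ mf mI.
have epT : ep by move: (ah t); rewrite th; case: (ep).
have [u um] : monmult a (m + minc h mu)%MM.
  apply: fI; rewrite coefB skcoefMr skcoefMr0 ?sub0r ?oppr_eq0.
    by rewrite !mulf_neq0 ?sktwist_neq0 // gep.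
  by apply/mnm_lepP => /(_ h); rewrite mnm1E eqxx mnmDE m0 minch.
have uh : a u h = 0%N.
  by apply/eqP; have /mnm_lepP/(_ h) := um; rewrite mnmDE m0 minch leqn0.
apply: mI; exists u; apply: (lem_liftP (h := h)) => [|i]; first by rewrite uh.
have [mui|mui] := posnP (mu i).
  by have /mnm_lepP/(_ (lift h i)) := um; rewrite mnmDE mincE mui addn0.
apply: leq_trans (achain epT th uh mui) _.
by have /mnm_lepP/(_ (lift h i)) := tm; rewrite mnmDE mnm1E (negPf (neq_lift _ _)) addn0.
Qed.

Lemma betti_subst (b : nat -> nat) : betti q' a' b ->
  betti q a (fun i => if i is j.+1 then b j + b j.+1 else b 0)%N.
Proof.
move=> [eps' epsE' Hb].
have [eps epsE] : exists eps : {rmorphism monquot q a -> k}, is_mqeps eps.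
  by apply: mqeps_exists => t; exact: ltnW.
exists eps => //.
have [|th thE] := @idquot_rmorphism _ (moneq (q := q) a) _
    (idproj (moneq (q := q') a') \o sksubst).
  move=> _ [t ->]; rewrite /= skmonE; have [c ->] := sksubst_term 1 (a t).
  by apply/idproj_eq0/(skterm_ideal subst_skew); exists t; rewrite -aE lepm_refl.
(* The coefficient of x_h is defined on the quotient because all generators have degree at least 2;
   it witnesses that [skdiff] is not in J^2. *)
have [|psi psiE] := @idquot_additive _ (moneq (q := q) a) k
    (HB.pack (@skcoef k _ q U_(h)%MM)
      (GRing.isZmodMorphism.Build _ _ _ (@skcoef_is_additive k _ q U_(h)%MM))).
  move=> r /(monidealP a qS)/(_ U_(h)%MM) H /=; apply/eqP; apply: contraT => /H[t tU].
  by have := adeg t; rewrite ltnNge -(mdeg1 h) -(submK tU) mdegD leq_addl.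
have [e [eS eJ]] := resfield_proj qS epsE.
have [e' [eS' eJ']] := resfield_proj subst_skew epsE'.
pose c := idproj (moneq (q := q) a) skdiff.
apply: (@tor_resfield_step k _ _ eps (mqsc q a) eps' (mqsc q' a') th c _ _ _ _ _ _ _ psi _ _
  (resfield q a) e eS eJ (resfield q' a') e' eS' eJ' b Hb).
- move=> y; have [f ->] := idprojP y; exists (idproj _ (skinc f)).
  by rewrite thE /= skincK.
- by move=> x; have [f ->] := idprojP x; rewrite thE epsE epsE' sksubst_coef0.
- by move=> x; rewrite thE /= sksubstC.
- move=> x; have [f ->] := idprojP x; rewrite thE /= idproj_eq0.
  split=> [|[y yE]]; last first.
    have [f1 f1E] := idprojP y; rewrite f1E /c -rmorphM in yE.
    apply/idproj_eq0; rewrite -[LHS]/((idproj _ \o sksubst) f) -thE yE thE /=.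
    by rewrite rmorphM sksubst_diff mulr0 rmorph0.
  have [g [x0 fE]] := skdiff_decomp f.
  rewrite fE rmorphD rmorphM sksubst_diff mulr0 addr0 skincK => /skinc_ideal[x1 H].
  exists (idproj _ (x1 + x0)); rewrite /c -rmorphM; apply/eq_idproj.
  by rewrite mulrDl [X in _ - X]addrC addrKA.
- move=> x; have [f ->] := idprojP x; rewrite /c -rmorphM => /idproj_eq0 H.
  by apply/idproj_eq0; exact: skdiff_regular.
- exact: mqscK.
- exact: mqscK.
- move=> x y; have [[f ->] [g ->]] := (idprojP x, idprojP y).
  rewrite -rmorphM !psiE !epsE /= skcoefM1 => -> /=.
  by rewrite mul0r addr0.
- move=> x; have [f ->] := idprojP x; rewrite /c -rmorphM psiE epsE /= skcoefM1.
  have [g dE gep] := skdiffE; rewrite dE !skcoef_is_additive !skcoefU mnm1_eq0 mulr0n.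
  have -> : (minc h mu == U_(h)%MM) = false.
    by apply/eqP => /(congr1 (fun m : 'X_{1..n.+1} => m h)); rewrite minch mnm1E eqxx.
  rewrite eqxx mulr0n subr0 mulr1 sub0r.
  suff -> : g *+ (minc h mu == 0%MM) = 0 by rewrite oppr0 mulr0 add0r.
  case: eqP => // m0; case: (eqVneq g 0) gep => [->|_ /esym epT]; first by rewrite mul0rn.
  case/eqP: (mu0 epT); apply/mnmP => i.
  by rewrite -(mincE h) m0 !mnm0E.
Qed.
End Substitution.

Definition mul1t (b : nat -> nat) (i : nat) : nat :=
  (if i is j.+1 then b j + b j.+1 else b 0)%N.

(** This ends the elimination: when no variable is left to remove, the increasing embedding is the
    identity, and the two rings coincide without a renaming of variables. *)
Lemma incr_ord_id n (f : 'I_n -> 'I_n) :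
  (forall i j : 'I_n, (i < j)%N -> (f i < f j)%N) -> f =1 id.
Proof.
move=> fI i; apply/val_inj/eqP; rewrite eqn_leq; apply/andP; split.
  have [d] := ubnP (n - i); elim: d i => // d IH i; rewrite ltnS => di.
  have [in'|ni] := ltnP i.+1 n; last first.
    by rewrite -ltnS (leq_trans (ltn_ord _) ni).
  rewrite -ltnS; apply: leq_trans (IH (Ordinal in') _); first exact: fI.
  by apply: leq_trans di; rewrite /= ltn_sub2l.
case: i => i; elim: i => [//|i IH] ni; have ni' := ltnW ni.
by apply: leq_ltn_trans (IH ni') _; exact: fI.
Qed.

(** * Elimination of several variables *)

Section Push.
Variables (n N : nat) (iota : 'I_n -> 'I_N).
Hypothesis iotaI : injective iota.

Definition mpush (m : 'X_{1..n}) : 'X_{1..N} := (\sum_i U_(iota i) *+ m i)%MM.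

Lemma mpushE m i : mpush m (iota i) = m i.
Proof.
rewrite mnm_sumE (bigD1 i) //= mulmnE mnm1E eqxx mul1n big1 ?addn0 // => j ji.
by rewrite mulmnE mnm1E (inj_eq iotaI) (negPf ji) mul0n.
Qed.

Lemma mpush0 m v : (forall i, iota i != v) -> mpush m v = 0%N.
Proof.
move=> vi; rewrite mnm_sumE big1 // => i _.
by rewrite mulmnE mnm1E (negPf (vi i)) mul0n.
Qed.

Lemma mpush_gt0 m v : (0 < mpush m v)%N -> exists2 i, iota i = v & (0 < m i)%N.
Proof.
have [/existsP[i /eqP <-]|] := boolP [exists i, iota i == v].
  by rewrite mpushE; exists i.
by rewrite negb_exists => /forallP vi; rewrite mpush0.
Qed.

Lemma mpush_eq0 m : (mpush m == 0%MM) = (m == 0%MM).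
Proof.
apply/eqP/eqP => [m0|->].
  by apply/mnmP => i; rewrite -mpushE m0 !mnm0E.
by rewrite /mpush big1 // => i _; rewrite mnm0E.
Qed.

Lemma prod_mpush (k : fieldType) (F : 'I_N -> k) m :
  \prod_v F v ^+ mpush m v = \prod_i F (iota i) ^+ m i.
Proof.
under eq_bigr do rewrite mnm_sumE expr_sum.
rewrite exchange_big; apply: eq_bigr => i _ /=.
rewrite (bigD1 (iota i)) //= mulmnE mnm1E eqxx mul1n big1 ?mulr1 // => v vi.
by rewrite mulmnE mnm1E eq_sym (negPf vi) mul0n.
Qed.
End Push.

Section Elimination.
Variables (k : fieldType) (s n : nat) (q0 : 'M[k]_n) (a0 : 'I_s -> 'X_{1..n}).

(* The variables outside the image of [iota] are replaced one after the other by
   the monomials [mu] (by 0 when [mu] is 1); the last two chain conditions make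
   each difference of a variable and its monomial a nonzerodivisor. *)
Record elimination (N : nat) (q : 'M[k]_N) (a : 'I_s -> 'X_{1..N})
    (iota : 'I_n -> 'I_N) (mu : 'I_N -> 'X_{1..n}) : Prop := Elimination {
  elim_incr : forall i j : 'I_n, (i < j)%N -> (iota i < iota j)%N;
  elim_skew : is_skew_mx q;
  elim_q0 : forall i j, q0 i j = q (iota i) (iota j);
  elim_color : forall v, v \notin codom iota -> mu v != 0%MM ->
    forall j, q v j = \prod_i q (iota i) j ^+ mu v i;
  elim_deg1 : forall t v, v \notin codom iota -> (a t v <= (mu v != 0%MM))%N;
  elim_mdeg : forall t, (1 < mdeg (a t))%N;
  elim_a0 : forall t i, a0 t i =
    (a t (iota i) + \sum_(v | v \notin codom iota) mu v i * a t v)%N;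
  elim_chain : forall v t u i, v \notin codom iota -> (0 < mu v i)%N ->
    a t v = 1%N -> a u v = 0%N -> (a u (iota i) <= a t (iota i))%N;
  elim_chain2 : forall v v' t u i, v \notin codom iota -> v' \notin codom iota ->
    (0 < mu v i)%N -> (0 < mu v' i)%N ->
    a t v = 1%N -> a u v = 0%N -> (a u v' <= a t v')%N
}.

Lemma betti_elimination r N (q : 'M[k]_N) (a : 'I_s -> 'X_{1..N}) iota mu b :
  N = (n + r)%N -> elimination q a iota mu ->
  betti q0 a0 b -> betti q a (iter r mul1t b).
Proof.
move=> + + b0; elim: r N q a iota mu => [|r IH] N q a iota mu.
  rewrite addn0 => eN; subst N => H; have iid := incr_ord_id (elim_incr H).
  have -> : q = q0 by apply/matrixP => i j; rewrite (elim_q0 H) !iid.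
  suff -> : a = a0 by [].
  apply: boolp.funext => t; apply/mnmP => i; rewrite (elim_a0 H) iid big_pred0 ?addn0 //.
  by move=> v; rewrite -[v]iid codom_f.
rewrite addnS => eN; subst N => -[incr qS qE color deg1 deg aE ch ch2].
have iI : injective iota.
  move=> i j e; apply/val_inj; case: (ltngtP i j) => // /incr.
    by rewrite e ltnn.
  by rewrite e ltnn.
have [h hP] : exists h : 'I_(n + r).+1, h \notin codom iota.
  apply/existsP; apply: contraT; rewrite negb_exists => /forallP H.
  suff : (#|'I_(n + r).+1| <= #|codom iota|)%N.
    by rewrite (card_codom iI) !card_ord ltnNge leq_addr.
  by apply: subset_leq_card; apply/subsetP => v _; rewrite -[_ \in _]negbK.
have /boolp.choice[io ioE] i : exists j : 'I_(n + r), iota i = lift h j.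
  case: (unliftP h (iota i)) => [j ->|e]; first by exists j.
  by rewrite -e codom_f in hP.
have ioI : injective io by move=> i j e; apply: iI; rewrite !ioE e.
have cod j : (lift h j \notin codom iota) = (j \notin codom io).
  congr (~~ _); apply/codomP/codomP => -[i].
    by rewrite ioE => /lift_inj ->; exists i.
  by move=> ->; exists i; rewrite ioE.
pose m := mpush io (mu h).
pose q' : 'M[k]_(n + r) := \matrix_(i, j) q (lift h i) (lift h j).
pose a' (t : 'I_s) : 'X_{1..n + r} := (mrest h (a t) + m *+ a t h)%MM.
have a'out t j : j \notin codom io -> a' t j = a t (lift h j).
  move=> jio; rewrite mnmDE mrestE mulmnE /m mpush0 ?mul0n ?addn0 // => i.
  by apply: contraNneq jio => <-; rewrite codom_f.
have a'in t i : a' t (io i) = (a t (iota i) + mu h i * a t h)%N.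
  by rewrite mnmDE mrestE mulmnE /m mpushE // ioE.
have m0 : (m != 0%MM) = (mu h != 0%MM) by rewrite mpush_eq0.
(* Degrees do not drop: x_h is replaced by a monomial of positive degree unless it is absent from
   [a t]. *)
have a'deg t : (1 < mdeg (a' t))%N.
  apply: leq_trans (deg t) _; rewrite mdegD mdegMn [mdeg (a t)]mdegE (bigD1_ord h) //= addnC.
  rewrite [mdeg (mrest _ _)]mdegE; under [X in (_ <= X + _)%N]eq_bigr do rewrite mrestE.
  rewrite leq_add2l; have := deg1 t h hP.
  case: eqP => [_|/eqP mh _]; first by rewrite leqn0 => /eqP->.
  by rewrite -{1}[a t h]mul1n leq_mul2r lt0n mdeg_eq0 m0 mh orbT.
have B : betti q' a' (iter r mul1t b).
  apply: (IH _ q' a' io (fun j => mu (lift h j))) => //; split=> //.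
  - move=> i j /incr; rewrite !ioE !ltnNge; apply: contra.
    by rewrite /= leq_bump2.
  - by case: qS => [qn0 q1 qV]; split=> *; rewrite !mxE.
  - by move=> i j; rewrite mxE -!ioE.
  - move=> v; rewrite -cod => vi mv j; rewrite mxE color //.
    by apply: eq_bigr => i _; rewrite mxE ioE.
  - by move=> t v vi; rewrite a'out // deg1 // cod.
  - move=> t i; rewrite aE a'in big_mkcond (bigD1_ord h) //= hP addnA; congr (_ + _)%N.
    rewrite [RHS]big_mkcond; apply: eq_bigr => j _; rewrite cod.
    by case: ifP => // jio; rewrite a'out.
  (* The new exponent is a sum: the first chain condition compares the old parts, the second one,
     for [v] and [h], the parts contributed by [h]. *)
  - move=> v t u i vi mi; rewrite !(a'out _ _ vi) => tv uv; rewrite !a'in leq_add //.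
      by apply: (ch (lift h v)) => //; rewrite cod.
    have [->|mhi] := posnP (mu h i); first by rewrite !mul0n.
    rewrite leq_mul2l; apply/orP; right.
    by apply: (ch2 (lift h v) h t u i) => //; rewrite cod.
  - move=> v v' t u i vi vi' mi mi'; rewrite !(a'out _ _ vi) !(a'out _ _ vi').
    by apply: (ch2 _ _ _ _ i) => //; rewrite cod.
apply: (betti_subst (q := q) (q' := q') (a := a) (a' := a') (h := h)
  (ep := mu h != 0%MM) (mu := m) _ _ _ _ _ _ _ _ B) => //.
- by move=> i j; rewrite mxE.
- move=> mh j; rewrite color // prod_mpush; apply: eq_bigr => i _.
  by rewrite mxE ioE.
- by rewrite m0.
- by move=> t; exact: deg1.
- move=> _ t u th uh l /(mpush_gt0 ioI)[i <- mi].
  by rewrite -ioE; exact: (ch h).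
Qed.
End Elimination.

(** * Power series *)

Definition zmul1t (f : nat -> int) (i : nat) : int :=
  f i + (if i is j.+1 then f j else 0).

(** The recursion solves (1 + t) g = f for a power series g; its subtractions are the reason for
    integer coefficients. *)
Fixpoint zdiv1t (f : nat -> int) (i : nat) : int :=
  f i - (if i is j.+1 then zdiv1t f j else 0).

Lemma zmul1tK f : zmul1t (zdiv1t f) =1 f.
Proof. by case=> [|i]; rewrite /zmul1t /= subrK. Qed.

Lemma zdiv1tK f : zdiv1t (zmul1t f) =1 f.
Proof.
elim=> [|i IH] /=; first by rewrite /zmul1t subr0 addr0.
by rewrite IH /zmul1t addrK.
Qed.

Lemma iter_zmul1tK n f : iter n zmul1t (iter n zdiv1t f) = f.
Proof.
by elim: n f => // n IH f; rewrite iterSr /= (boolp.funext (zmul1tK _)) IH.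
Qed.

Lemma iter_zmul1t_inj n f g : iter n zmul1t f = iter n zmul1t g -> f = g.
Proof.
elim: n => // n IH /= e; apply: IH.
by rewrite -(boolp.funext (zdiv1tK (iter n zmul1t f))) e (boolp.funext (zdiv1tK _)).
Qed.

Lemma iter_mul1tE n (b : nat -> nat) :
  (fun i => (iter n mul1t b i)%:Z) = iter n zmul1t (fun i => (b i)%:Z).
Proof.
elim: n => //= n <-; apply: boolp.funext => -[|i]; rewrite /zmul1t /= ?addr0 //.
by rewrite PoszD addrC.
Qed.

Lemma is_quot_1tE (P : nat -> nat) n f :
  is_quot_1t P n f <-> (fun i => (P i)%:Z) = iter n zmul1t f.
Proof.
suff H i : \sum_(j < i.+1) (((1 + 'X) ^+ n : {poly int})`_j) * f (i - j)%N =
    iter n zmul1t f i.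
  split=> [Pf|e i]; first by apply: boolp.funext => i; rewrite Pf H.
  by rewrite H -e.
elim: n i => [|n IH] i.
  rewrite expr0 big_ord_recl coefC eqxx mul1r subn0 big1 ?addr0 // => j _.
  by rewrite coefC mul0r.
rewrite iterS /zmul1t -IH exprSr mulrDr mulr1.
under eq_bigr do rewrite coefD coefMX mulrDl.
rewrite big_split; congr (_ + _); rewrite big_ord_recl /= mul0r add0r.
by case: i => [|i]; rewrite ?big_ord0 // -IH; apply: eq_bigr => j _; rewrite subSS.
Qed.

(** * Squarefree monomials *)

Section Polarization.
Variables (s n : nat) (a : 'I_s -> 'X_{1..n}).

(* The number of copies of each variable dividing, in the polarization of the
   monomials [a t], exactly those with [t \in A]. *)
Definition polar (A : {set 'I_s}) : 'X_{1..n} :=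
  [multinom (\sum_(e < \sum_t mdeg (a t)) ([set t | (e < a t i)%N] == A))%N | i < n].

Lemma polar_gt0 A i : (0 < polar A i)%N ->
  exists e, A = [set t | (e < a t i)%N].
Proof.
rewrite mnmE lt0n sum_nat_eq0 negb_forall => /existsP[e] /=.
by rewrite eqb0 negbK => /eqP <-; exists e.
Qed.

(** The level sets {u | e < a_u(i)} that contain t are those with e < a_t(i). The common bound on e
    is at least every exponent, and its surplus values give the empty set, which contains no t. *)
Lemma sum_polar t i : (\sum_(A : {set 'I_s} | t \in A) polar A i = a t i)%N.
Proof.
under eq_bigr do rewrite mnmE.
rewrite exchange_big /= (eq_bigr (fun e : 'I__ => if (e < a t i)%N then 1%N else 0%N)) => [|e _].
  have aD : (a t i <= \sum_t mdeg (a t))%N.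
    rewrite (bigD1 t) //= [mdeg (a t)]mdegE (bigD1 i) //= -addnA; exact: leq_addr.
  by rewrite -big_mkcond -(big_ord_widen _ (fun=> 1%N)) // sum1_card card_ord.
pose B := [set u | (e < a u i)%N]; rewrite -/B.
have -> : (e < a t i)%N = (t \in B) by rewrite inE.
have [tB|tB] := boolP (t \in B).
  by rewrite (bigD1 B) //= eqxx big1 // => A /andP[_ /negPf AB]; rewrite eq_sym AB.
by rewrite big1 // => A tA; case: eqP => // BA; rewrite BA tA in tB.
Qed.

(** A single variable is split off, so both factors are nontrivial once the degree is at least 2. *)
Lemma mnm_split (m : 'X_{1..n}) : exists m1 m2 : 'X_{1..n},
  m = (m1 + m2)%MM /\ (minn 2 (mdeg m) <= (m1 != 0%MM) + (m2 != 0%MM))%N.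
Proof.
have [->|m0] := eqVneq m 0%MM.
  by exists 0%MM, 0%MM; rewrite addm0 mdeg0 minn0.
have [i mi] : exists i, (0 < m i)%N.
  apply/existsP; apply: contraNT m0; rewrite negb_exists => /forallP m0.
  by apply/eqP/mnmP => i; rewrite mnm0E; apply/eqP; rewrite -leqn0 leqNgt m0.
have im : (U_(i) <= m)%MM by apply/mnm_lepP => j; rewrite mnm1E; case: eqP => // <-.
exists U_(i)%MM, (m - U_(i))%MM; split; first by rewrite addmC submK.
rewrite mnm1_eq0 -{1}(submK im) mdegD mdeg1 -mdeg_eq0.
by case: (mdeg _) => [|d]; rewrite ?geq_minr ?geq_minl.
Qed.

Lemma polarization : (forall t, 1 < mdeg (a t))%N ->
  exists mu : {set 'I_s} * bool -> 'X_{1..n},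
  [/\ forall t i, (a t i = \sum_(w : {set 'I_s} * bool | t \in w.1) mu w i)%N,
      forall w i, (0 < mu w i)%N -> exists e, w.1 = [set t | (e < a t i)%N]
    & forall t, (1 < \sum_(w : {set 'I_s} * bool | t \in w.1) (mu w != 0%MM))%N].
Proof.
move=> adeg.
have /boolp.choice[f fP] A : exists m : 'X_{1..n} * 'X_{1..n}, polar A = (m.1 + m.2)%MM /\
    (minn 2 (mdeg (polar A)) <= (m.1 != 0%MM) + (m.2 != 0%MM))%N.
  by have [m1 [m2 H]] := mnm_split (polar A); exists (m1, m2).
pose mu (w : {set 'I_s} * bool) := if w.2 then (f w.1).1 else (f w.1).2.
have sumw t (F : {set 'I_s} * bool -> nat) : (\sum_(w : {set 'I_s} * bool | t \in w.1) F w =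
    \sum_(A : {set 'I_s} | t \in A) (F (A, true) + F (A, false)))%N.
  under [RHS]eq_bigr => A _ do rewrite -[(_ + _)%N](big_bool _ (fun b => F (A, b))).
  by rewrite pair_big_dep /=; apply: eq_big => [[A b]|[A b] _] //=; rewrite andbT.
exists mu; split=> [t i|w i wi|t].
- rewrite sumw -sum_polar; apply: eq_bigr => A _.
  by rewrite (fP A).1 mnmDE.
- apply: (@polar_gt0 _ i); rewrite (fP w.1).1 mnmDE addn_gt0; move: wi.
  by rewrite /mu; case: w.2 => ->; rewrite ?orbT.
- rewrite sumw; apply: leq_trans (_ : minn 2 (mdeg (a t)) <= _)%N.
    by rewrite leq_min adeg.
  have -> : mdeg (a t) = (\sum_(A : {set 'I_s} | t \in A) mdeg (polar A))%N.
    rewrite mdegE; under eq_bigr do rewrite -sum_polar.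
    by rewrite exchange_big; apply: eq_bigr => A _; rewrite mdegE.
  (* Truncation at 2 is subadditive, so the bounds for the separate factors add up to one for
     [a t]. *)
  apply: leq_trans (_ : \sum_(A : {set 'I_s} | t \in A) minn 2 (mdeg (polar A)) <= _)%N.
    apply: (big_rec2 (fun x y => minn 2 x <= y)%N) => [|A x y _ xy]; first by rewrite minn0.
    by lia.
  by apply: leq_sum => A _; case: (fP A).
Qed.
End Polarization.

(** * Colors, and the comparison of rings of equal shape *)

Section Colors.
Variables (k : fieldType) (s : nat) (gT : finGroupType) (G : {group gT}).
Variables (chi : gT -> gT -> k) (hchi : is_alt_bicharacter G chi).

Lemma bichar1 h : h \in G -> chi 1%g h = 1.
Proof.
case: hchi => chi0 chiM _ _ hG; apply: (mulfI (chi0 _ _ (group1 G) hG)).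
by rewrite -chiM ?mulg1 ?mulr1.
Qed.

Lemma bicharC g h : g \in G -> h \in G -> chi g h = (chi h g)^-1.
Proof.
case: hchi => chi0 chiMl chiMr chi1 gG hG.
have := chi1 _ (groupM gG hG); rewrite chiMl ?chiMr ?groupM // !chi1 // mul1r mulr1.
by move=> e; apply: (mulIf (chi0 _ _ hG gG)); rewrite e mulVf // chi0.
Qed.

(** A variable with the color of a monomial thereby commutes with every other variable by the same
    scalar as the monomial does. *)
Lemma bichar_prod n (g : 'I_n -> gT) (m : 'X_{1..n}) h :
  (forall i, g i \in G) -> h \in G ->
  (\prod_i g i ^+ m i)%g \in G /\
  chi (\prod_i g i ^+ m i)%g h = \prod_i chi (g i) h ^+ m i.
Proof.
move=> gG hG; have [_ chiM _ _] := hchi.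
pose T x c := x \in G /\ chi x h = c.
apply: (big_ind2 T) => [|x c y d [xG <-] [yG <-]|i _].
- by split; rewrite ?group1 ?bichar1.
- by split; rewrite ?groupM // chiM.
split; first by rewrite groupX.
elim: (m i) => [|d IH]; first by rewrite expg0 bichar1.
by rewrite expgS chiM ?groupX // IH exprS.
Qed.

Definition color_mx N (c : 'I_N -> gT) : 'M[k]_N := \matrix_(i, j) chi (c i) (c j).

Lemma color_mx_skew N (c : 'I_N -> gT) : (forall i, c i \in G) ->
  is_skew_mx (color_mx c).
Proof.
case: (hchi) => chi0 _ _ chi1 cG; split=> [i j|i|i j]; rewrite !mxE.
- by rewrite chi0.
- by rewrite chi1.
- by rewrite bicharC.
Qed.

Local Notation W := ({set 'I_s} * bool)%type.

(* The finite datum that determines the quotient P / (1 + t)^n: the variables of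
   the polarization with their colors. *)
Definition shape := {ffun W -> option gT}.

Record has_shape (cl : shape) n (q : 'M[k]_n) (a : 'I_s -> 'X_{1..n})
    (g : 'I_n -> gT) (mu : W -> 'X_{1..n}) : Prop := HasShape {
  shape_G : forall i, g i \in G;
  shape_q : q = color_mx g;
  shape_cl : forall w, cl w =
    if mu w == 0%MM then None else Some (\prod_i g i ^+ mu w i)%g;
  shape_sum : forall t i, (a t i = \sum_(w : W | t \in w.1) mu w i)%N;
  shape_chain : forall w i, (0 < mu w i)%N -> exists e, w.1 = [set t | (e < a t i)%N];
  shape_deg : forall t, (1 < \sum_(w : W | t \in w.1) (mu w != 0%MM))%N
}.

Lemma shape_colorG cl n (q : 'M[k]_n) a g mu w :
  has_shape cl q a g mu -> odflt 1%g (cl w) \in G.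
Proof.
move=> H; rewrite (shape_cl H); case: ifP => _ /=; first exact: group1.
by case: (bichar_prod (mu w) (shape_G H) (group1 G)).
Qed.

(** All variables outside [iota] are eliminated: [om w] becomes its monomial, or 0 if [w] does not
    occur, and the variables outside both ranges, such as those of a second ring, become 0. *)
Lemma betti_polarization cl n (q : 'M[k]_n) a g mu N r (c : 'I_N -> gT)
    (A : 'I_s -> 'X_{1..N}) (iota : 'I_n -> 'I_N) (om : W -> 'I_N) b :
  has_shape cl q a g mu -> N = (n + r)%N ->
  (forall i j : 'I_n, (i < j)%N -> (iota i < iota j)%N) ->
  injective om -> (forall w i, om w != iota i) ->
  (forall v, c v \in G) -> (forall i, c (iota i) = g i) ->
  (forall w, c (om w) = odflt 1%g (cl w)) ->
  (forall t w, A t (om w) = (t \in w.1) && (cl w != None)) ->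
  (forall t v, v \notin codom om -> A t v = 0%N) ->
  betti q a b -> betti (color_mx c) A (iter r mul1t b).
Proof.
move=> H eN incr omI omi cG ci co Ao A0.
pose mv v := if [pick w | om w == v] is Some w then mu w else 0%MM.
have mvo w : mv (om w) = mu w.
  rewrite /mv; case: pickP => [w' /eqP /omI -> //|/(_ w)].
  by rewrite eqxx.
have mv0 v : v \notin codom om -> mv v = 0%MM.
  move=> vo; rewrite /mv; case: pickP => // w /eqP e.
  by rewrite -e codom_f in vo.
have iA t i : A t (iota i) = 0%N.
  by apply: A0; apply/codomP => -[w e]; have := omi w i; rewrite e eqxx.
have clE w : (cl w != None) = (mu w != 0%MM) by rewrite (shape_cl H); case: (mu w == _).
have omP v i : (0 < mv v i)%N -> exists w, v = om w.
  have [/codomP[w ->]|/mv0->] := boolP (v \in codom om); first by exists w.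
  by rewrite mnm0E.
have sumE (F : 'I_N -> nat) : (forall v, v \notin codom om -> F v = 0%N) ->
    (\sum_v F v = \sum_w F (om w))%N.
  move=> F0; rewrite (bigID (fun v => v \in codom om)) /= [X in (_ + X)%N]big1 // addn0.
  by rewrite -big_uniq ?big_image //; exact/injectiveP.
apply: (betti_elimination (iota := iota) (mu := mv) eN); split=> //.
- exact: color_mx_skew.
- by move=> i j; rewrite (shape_q H) !mxE !ci.
- move=> v _ /eqP mv_n0 j; have [/codomP[w vw]|/mv0//] := boolP (v \in codom om).
  rewrite vw mvo mxE co (shape_cl H) ifF; last by apply/eqP; rewrite -mvo -vw.
  rewrite (bichar_prod (mu w) (shape_G H) (cG j)).2.
  by apply: eq_bigr => i _; rewrite mxE ci.
- move=> t v _; have [/codomP[w ->]|/[dup] vo /A0->//] := boolP (v \in codom om).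
  by rewrite Ao mvo clE; case: (_ \in _); rewrite ?leqnn.
- move=> t; apply: leq_trans (shape_deg H t) _; rewrite mdegE sumE; last exact: A0.
  rewrite big_mkcond; apply: leq_sum => w _; rewrite Ao clE.
  by case: (t \in _).
- move=> t i; rewrite iA add0n (shape_sum H) big_mkcond [RHS]big_mkcond sumE.
    apply: eq_bigr => w _; have -> : om w \notin codom iota.
      by apply/codomP => -[j e]; have := omi w j; rewrite e eqxx.
    rewrite mvo Ao clE; case: (t \in _); rewrite ?muln0 //=.
    by case: eqP => [->|_]; rewrite ?mnm0E ?muln1.
  by move=> v vo; rewrite mv0 // mnm0E mul0n if_same.
- by move=> v t u i _ _ _ _; rewrite !iA.
- move=> v v' t u i _ _ vi vi'; have [w vw] := omP _ _ vi; have [w' vw'] := omP _ _ vi'.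
  subst v v'; rewrite !mvo in vi vi'; rewrite !Ao !clE.
  have -> : mu w != 0%MM by apply: contraTneq vi => ->; rewrite mnm0E.
  (* Both index sets are level sets of the exponents of the same variable [i], hence nested. *)
  have [[e ->] [e' ->]] := (shape_chain H vi, shape_chain H vi').
  rewrite !andbT !inE; case: ltnP => // et _; case: ltnP => // ue _.
  by case: ltnP => // e'u; rewrite (leq_ltn_trans (leq_trans (ltnW e'u) ue) et) leqnn.
Qed.

(** The common ring has p + n' variables more than the first ring and p + n more than the second, so
    its series is both (1 + t)^(p + n') b and (1 + t)^(p + n) b'. The factor (1 + t)^p cancels over
    the integers. *)
Lemma betti_same_shape cl n (q : 'M[k]_n) a g mu b n' (q' : 'M[k]_n') a' g' mu' b' :
  has_shape cl q a g mu -> has_shape cl q' a' g' mu' ->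
  betti q a b -> betti q' a' b' -> iter n' mul1t b = iter n mul1t b'.
Proof.
move=> H H' Hb Hb'; set p := #|{: W}|.
(* The order x, w, x' of the variables makes both embeddings increasing. An absent [w] gets color 1;
   it will be replaced by 0, which puts no condition on its color. *)
pose c (v : 'I_(n + (p + n'))) : gT := match split v with
  | inl i => g i
  | inr v' => match split v' with
     | inl w => odflt 1%g (cl (enum_val w))
     | inr i => g' i
     end
  end.
pose A t : 'X_{1..n + (p + n')} := [multinom match split v with
  | inl i => 0%N
  | inr v' => match split v' with
     | inl w => ((t \in (enum_val w).1) && (cl (enum_val w) != None) : nat)
     | inr i => 0%N
     end
  end | v < n + (p + n')].
pose om w : 'I_(n + (p + n')) := rshift n (lshift n' (enum_rank w)).
pose io (i : 'I_n) : 'I_(n + (p + n')) := lshift (p + n') i.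
pose io' i : 'I_(n + (p + n')) := rshift n (rshift p i).
have spl (m1 m2 : nat) (i : 'I_m1) : split (lshift m2 i) = inl i := unsplitK (inl i).
have spr (m1 m2 : nat) (i : 'I_m2) : split (rshift m1 i) = inr i := unsplitK (inr i).
have cG v : c v \in G.
  rewrite /c; case: (split v) => [i|v']; first exact: (shape_G H).
  by case: (split v') => [w|i]; [exact: shape_colorG H | exact: (shape_G H')].
have omI : injective om.
  by move=> w w' /rshift_inj/lshift_inj/enum_rank_inj.
have co w : c (om w) = odflt 1%g (cl w) by rewrite /c /om spr spl enum_rankK.
have Ao t w : A t (om w) = (t \in w.1) && (cl w != None).
  by rewrite mnmE /om spr spl enum_rankK.
have A0 t v : v \notin codom om -> A t v = 0%N.
  rewrite mnmE -[v]splitK; case: (split v) => [i|v'] /=; first by rewrite spl.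
  rewrite spr -[v']splitK; case: (split v') => [w|i] /=; last by rewrite spr.
  by rewrite -[w]enum_valK -[rshift _ _]/(om (enum_val w)) codom_f.
have T : betti (color_mx c) A (iter (p + n') mul1t b).
  apply: (betti_polarization (iota := io) (om := om) H) Hb => //.
  - by move=> w i; rewrite /om /io eq_sym eq_lrshift.
  - by move=> i; rewrite /c /io spl.
have T' : betti (color_mx c) A (iter (p + n) mul1t b').
  apply: (betti_polarization (iota := io') (om := om) H') Hb' => //.
  - by rewrite addnA addnC [(p + n)%N]addnC.
  - by move=> i j ij; rewrite /= !ltn_add2l.
  - by move=> w i; rewrite /om /io' eq_rshift eq_lrshift.
  - by move=> i; rewrite /c /io' !spr.
have := betti_uniq T T'; rewrite !iterD => e.
apply: boolp.funext => i; apply/eqP; rewrite -eqz_nat; apply/eqP.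
have : iter p zmul1t (fun i => (iter n' mul1t b i)%:Z) =
       iter p zmul1t (fun i => (iter n mul1t b' i)%:Z).
  by rewrite -!iter_mul1tE; apply: boolp.funext => j; rewrite e.
by move/iter_zmul1t_inj/(congr1 (fun f => f i)).
Qed.

Lemma shape_quotient (cl : shape) : exists f : nat -> int,
  forall n (q : 'M[k]_n) a g mu b,
    has_shape cl q a g mu -> betti q a b -> is_quot_1t b n f.
Proof.
have [[n [q [a [g [mu [b [H Hb]]]]]]]|no] := boolp.EM (exists n (q : 'M[k]_n) a g mu b,
  has_shape cl q a g mu /\ betti q a b); last first.
  (* No ring has this shape, so 0 is an arbitrary choice. *)
  exists (fun=> 0) => n q a g mu b H Hb; case: no.
  by exists n, q, a, g, mu, b.
(* The series is read off from one ring of the given shape. *)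
exists (iter n zdiv1t (fun i => (b i)%:Z)) => n' q' a' g' mu' b' H' Hb'.
apply/is_quot_1tE/(@iter_zmul1t_inj n).
rewrite -iter_mul1tE -(betti_same_shape H H' Hb Hb') iter_mul1tE.
by rewrite -iterD addnC iterD iter_zmul1tK.
Qed.

Lemma has_shape_exists n (q : 'M[k]_n) (a : 'I_s -> 'X_{1..n}) :
  has_colors G chi q -> (forall t, 1 < mdeg (a t))%N ->
  exists cl g mu, has_shape cl q a g mu.
Proof.
move=> [phi [_ _ phiS phiq]] adeg.
have /boolp.choice[g gP] i : exists x, x \in G /\ phi x = sksigma q i.
  have [x xG xE] : exists2 x, x \in G & phi x = sksigma q i.
    by apply/phiS; exact: skcolor_sigma.
  by exists x.
have [mu [mu1 mu2 mu3]] := polarization adeg.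
exists [ffun w => if mu w == 0%MM then None else Some (\prod_i g i ^+ mu w i)%g], g, mu.
split=> // [i||w]; [by case: (gP i) | | by rewrite ffunE].
apply/matrixP => i j; rewrite mxE; have [[gi ei] [gj ej]] := (gP i, gP j).
by rewrite (phiq i j).
Qed.
End Colors.

Theorem corollary7p10 (k : fieldType) (s : nat) (gT : finGroupType)
    (G : {group gT}) (hG : abelian G) (chi : gT -> gT -> k)
    (hchi : is_alt_bicharacter G chi) :
  exists (N : nat) (L : 'I_N -> nat -> int),
    forall (n : nat) (q : 'M[k]_n) (a : 'I_s -> 'X_{1..n}) (P : nat -> nat),
      is_skew_mx q ->
      has_colors G chi q ->
      (forall i, (2 <= mdeg (a i))%N) ->
      is_poincare_resfield q a P ->
      exists l : 'I_N, is_quot_1t P n (L l).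
Proof.
have /boolp.choice[f fP] := shape_quotient (s := s) hchi.
(* The bound counts shapes, which form a finite type depending only on [s] and [gT]. *)
exists #|{: shape s gT}|, (fun l => f (enum_val l)) => n q a P qS qG adeg aP.
have [cl [g [mu H]]] := has_shape_exists qG adeg.
exists (enum_rank cl); rewrite enum_rankK; apply: fP H _.
by apply: betti_resolution => // t; exact: ltnW.
Qed.
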